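(* Let $\Delta T^{a\beta}=B^{a\beta c\delta}(\psi)\,\partial\psi_c/\partial x^\delta$ be any linear gradient form with coefficients $B^{a\beta c\delta}$ depending smoothly on the state $\psi\in\mathcal D$. Let $\lambda,\mu,\nu$ be smooth real functions on $\mathcal D$, and let $C=(C^a_{\tilde a})$ be the matrix field $$C^\alpha_{\tilde\alpha}=\frac{\mu}{\theta^2}U^\alpha U_{\tilde\alpha}+\frac{\nu}{\theta}\Pi^\alpha_{\tilde\alpha}\quad(\alpha,\tilde\alpha\in\{0,1,2,3\}),\qquad C^4_4=\lambda,\qquad C^\alpha_4=C^4_\alpha=0 .$$ Then the Eulerian gradient shift $$\psi^a=\tilde\psi^a+\epsilon(\Delta\tilde\psi)^a,\qquad (\Delta\tilde\psi)^a=S^{a\beta c}(\tilde\psi)\frac{\partial\tilde\psi_c}{\partial x^\beta},\qquad S^{a\beta c}=C^a_{\tilde a}\frac{\partial T^{\tilde a\beta}}{\partial\psi_c},$$ is a second-order equivalence transformation between $$(\mathrm I)\quad \frac{\partial}{\partial x^\beta}\Big(T^{a\beta}(\psi)+\epsilon B^{a\beta c\delta}(\psi)\frac{\partial\psi_c}{\partial x^\delta}\Big)=0$$ and $$(\mathrm{II})\quad \frac{\partial}{\partial x^\beta}\Big(T^{a\beta}(\tilde\psi)+\epsilon\tilde B^{a\beta c\delta}(\tilde\psi)\frac{\partial\tilde\psi_c}{\partial x^\delta}\Big)=0,\qquad \tilde B^{a\beta c\delta}=B^{a\beta c\delta}+\frac{\partial T^{a\beta}}{\partial\psi_f}S_f{}^{\delta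 c}.$$ That is, whenever $(\tilde\psi^\epsilon)_{0<\epsilon\le\epsilon_0}$ is a bounded smooth family such that, with $\psi^\epsilon$ obtained from $\tilde\psi^\epsilon$ by $(\psi^\epsilon)^a=(\tilde\psi^\epsilon)^a+\epsilon\,S^{a\beta c}(\tilde\psi^\epsilon)\,\partial\tilde\psi^\epsilon_c/\partial x^\beta$ and with values in a fixed compact subset of $\mathcal D$, either $\tilde\psi^\epsilon$ solves (II) for all $\epsilon$ or $\psi^\epsilon$ solves (I) for all $\epsilon$, one has $$T^{a\beta}(\psi^\epsilon)+\epsilon B^{a\beta c\delta}(\psi^\epsilon)\frac{\partial\psi^\epsilon_c}{\partial x^\delta}=T^{a\beta}(\tilde\psi^\epsilon)+\epsilon\tilde B^{a\beta c\delta}(\tilde\psi^\epsilon)\frac{\partial\tilde\psi^\epsilon_c}{\partial x^\delta}+O(\epsilon^3).$$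
   Context: Setting: Minkowski space $\mathbb R^4$ with coordinates $x^\beta$, metric $g_{\alpha\beta}$ of signature $(-,+,+,+)$, summation convention. Greek indices run over $0,1,2,3$; indices $a,c,f,\tilde a$ run over $0,\dots,4$; Greek-range indices are raised and lowered with $g$, while for the index $4$ upper and lower positions are identified. Fluid: $U^\alpha$ is the future-directed 4-velocity, $U^\alpha U_\alpha=-1$, $\Pi^{\alpha\beta}=g^{\alpha\beta}+U^\alpha U^\beta$. The state variables (Godunov variables) are $\psi_\alpha=U_\alpha/\theta$ ($\theta>0$ temperature) and $\psi_4=g/\theta$ (chemical potential divided by temperature), ranging over the open set $\mathcal D$ of states for which $(\psi^\alpha)$ is future-directed timelike and $(\theta,\psi_4)$ lies in the domain of the equation of state $p=p(\theta,\psi_4)$, a smooth function with $p_\theta>0$, $p_{\psi_4}>0$. Energy density and particle density are $\rho=\theta p_\theta-p$, $n=p_{\psi_4}/\theta$. The ideal tensor is $T^{\alpha\beta}=(\rho+p)U^\alpha U^\beta+p g^{\alpha\beta}$ for $\alpha\le 3$ and $T^{4\beta}=N^\beta=nU^\beta$; equivalently $T^{a\beta}=\partial(p\,\psi^\beta)/\partial\psi_a$. A bounded smooth family is a family of smooth functions $\tilde\psi^\epsilon:\Omega\to\mathcal D$, $0<\epsilon\le\epsilon_0$, on an open $\Omega\subset\mathbb R^4$, with values in a fixed compact subset of $\mathcal D$ and with each partial derivative of every order bounded on $\Omega$ uniformly in $\epsilon$. $O(\epsilon^k)$ denotes a quantity which together with each of its partial derivatives is bounded by a constant times $\epsilon^k$,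 uniformly on $\Omega$. *)

(* Defs.v *)
From HB Require Import structures.
From mathcomp Require Import all_boot all_order all_algebra.
From mathcomp Require Import all_classical all_reals all_analysis.

Set Implicit Arguments.
Unset Strict Implicit.
Unset Printing Implicit Defensive.
Import Order.TTheory GRing.Theory Num.Theory.
Import numFieldNormedType.Exports.
Local Open Scope classical_set_scope.
Local Open Scope ring_scope.

Definition partial (R : realType) (n : nat) (i : 'I_n) (f : 'rV[R]_n -> R)
  : 'rV[R]_n -> R := fun x => 'D_(delta_mx 0 i) f x.

(* [[:: i1; ...; ik]] stands for d_i1 (... (d_ik f)). *)
Definition ipartial (R : realType) (n : nat) (s : seq 'I_n) (f : 'rV[R]_n -> R)
  : 'rV[R]_n -> R := foldr (@partial R n) f s.

(* C^oo on an open set: every iterated partial derivative is Frechet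
   differentiable, hence continuous, at every point. *)
Definition smooth_on (R : realType) (n : nat) (A : set 'rV[R]_n)
    (f : 'rV[R]_n -> R) : Prop :=
  forall (s : seq 'I_n) (x : 'rV[R]_n), A x -> differentiable (ipartial s f) x.

(* Each iterated derivative has its own constant [M], uniform in [eps]
   and in the point. *)
Definition isO (R : realType) (n : nat) (eps0 : R) (Om : set 'rV[R]_n) (k : nat)
    (q : R -> 'rV[R]_n -> R) : Prop :=
  (forall eps, 0 < eps <= eps0 -> smooth_on Om (q eps)) /\
  (forall s : seq 'I_n, exists M : R, forall eps x,
     0 < eps <= eps0 -> Om x -> `|ipartial s (q eps) x| <= M * eps ^+ k).

(* A state is the row of its covariant components psi_0, ..., psi_4, and a point
   of space-time the row of its coordinates x^0, ..., x^3.  A Greek index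
   [al : 'I_4], seen as an index in 0..4, is [lift ord_max al] (same value);
   [unlift ord_max a] is [Some al] for a = al <= 3 and [None] for a = 4.
   In names, "low", "up" and "mix" give the position of the index (for [Slow]
   and [Sup], of the first one; the others are upper). *)

(* For n = 4 this is the Minkowski metric, its own inverse; for n = 5, the
   matrix that raises and lowers the indices in 0..4, index 4 being left alone. *)
Definition eta (R : realType) (n : nat) : 'M[R]_n :=
  diag_mx (\row_(i < n) if i == 0%N :> nat then -1 else 1).

Definition sharp (R : realType) (n : nat) (v : 'rV[R]_n) : 'rV[R]_n :=
  v *m eta R n.

Definition greek (R : realType) (psi : 'rV[R]_5) : 'rV[R]_4 :=
  \row_al psi 0 (lift ord_max al).

(* psi^al psi_al, which is - 1 / theta^2 since U^al U_al = -1 *)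
Definition msq (R : realType) (psi : 'rV[R]_5) : R :=
  \sum_(al < 4) sharp (greek psi) 0 al * greek psi 0 al.

Definition theta (R : realType) (psi : 'rV[R]_5) : R :=
  (Num.sqrt (- msq psi))^-1.

Definition Ulow (R : realType) (psi : 'rV[R]_5) : 'rV[R]_4 :=
  theta psi *: greek psi.

Definition Uup (R : realType) (psi : 'rV[R]_5) : 'rV[R]_4 := sharp (Ulow psi).

Definition Piup (R : realType) (psi : 'rV[R]_5) : 'M[R]_4 :=
  \matrix_(al, be) (eta R 4 al be + Uup psi 0 al * Uup psi 0 be).

Definition Pimix (R : realType) (psi : 'rV[R]_5) : 'M[R]_4 :=
  Piup psi *m eta R 4.

Definition thermo (R : realType) (psi : 'rV[R]_5) : 'rV[R]_2 :=
  \row_(i < 2) if i == 0 then theta psi else psi 0 ord_max.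

(* The second condition, psi^0 > 0, is future-directedness. *)
Definition states (R : realType) (E : set 'rV[R]_2) : set 'rV[R]_5 :=
  [set psi | [/\ msq psi < 0, 0 < sharp (greek psi) 0 0 & E (thermo psi)]].

Definition is_eos (R : realType) (E : set 'rV[R]_2) (p : 'rV[R]_2 -> R) : Prop :=
  [/\ open E,
      (forall w, E w -> 0 < w 0 0),
      smooth_on E p,
      (forall w, E w -> 0 < partial 0 p w) &
      (forall w, E w -> 0 < partial 1 p w)].

Definition pressure (R : realType) (p : 'rV[R]_2 -> R) (psi : 'rV[R]_5) : R :=
  p (thermo psi).

Definition energy_density (R : realType) (p : 'rV[R]_2 -> R) (psi : 'rV[R]_5) : R :=
  theta psi * partial 0 p (thermo psi) - pressure p psi.

Definition particle_density (R : realType) (p : 'rV[R]_2 -> R) (psi : 'rV[R]_5) : R :=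
  partial 1 p (thermo psi) / theta psi.

Definition T (R : realType) (p : 'rV[R]_2 -> R) (a : 'I_5) (be : 'I_4)
    (psi : 'rV[R]_5) : R :=
  if unlift ord_max a is Some al then
    (energy_density p psi + pressure p psi) * Uup psi 0 al * Uup psi 0 be
      + pressure p psi * eta R 4 al be
  else particle_density p psi * Uup psi 0 be.

(* T^{a be}(psi) + eps A^{a be c de}(psi) d psi_c / d x^de, at the point x *)
Definition flux (R : realType) (p : 'rV[R]_2 -> R)
    (A : 'I_5 -> 'I_4 -> 'I_5 -> 'I_4 -> 'rV[R]_5 -> R) (eps : R)
    (psi : 'rV[R]_4 -> 'rV[R]_5) (a : 'I_5) (be : 'I_4) (x : 'rV[R]_4) : R :=
  T p a be (psi x)
    + eps * \sum_(c < 5) \sum_(de < 4)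
        A a be c de (psi x) * partial de (fun y => psi y 0 c) x.

Definition solves (R : realType) (p : 'rV[R]_2 -> R)
    (A : 'I_5 -> 'I_4 -> 'I_5 -> 'I_4 -> 'rV[R]_5 -> R) (eps : R)
    (Om : set 'rV[R]_4) (psi : 'rV[R]_4 -> 'rV[R]_5) : Prop :=
  forall (a : 'I_5) x, Om x ->
    \sum_(be < 4) partial be (flux p A eps psi a be) x = 0.

(* C^a_b, the upper index being the row *)
Definition C (R : realType) (lambda mu nu : 'rV[R]_5 -> R) (psi : 'rV[R]_5)
  : 'M[R]_5 :=
  \matrix_(a, b)
    match unlift ord_max a, unlift ord_max b with
    | Some al, Some be =>
        mu psi / theta psi ^+ 2 * Uup psi 0 al * Ulow psi 0 be
          + nu psi / theta psi * Pimix psi al be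
    | None, None => lambda psi
    | _, _ => 0
    end.

Definition Sup (R : realType) (p : 'rV[R]_2 -> R) (lambda mu nu : 'rV[R]_5 -> R)
    (a : 'I_5) (be : 'I_4) (c : 'I_5) (psi : 'rV[R]_5) : R :=
  \sum_(b < 5) C lambda mu nu psi a b * partial c (T p b be) psi.

Definition Slow (R : realType) (p : 'rV[R]_2 -> R) (lambda mu nu : 'rV[R]_5 -> R)
    (f : 'I_5) (de : 'I_4) (c : 'I_5) (psi : 'rV[R]_5) : R :=
  \sum_(a < 5) eta R 5 f a * Sup p lambda mu nu a de c psi.

(* (Delta psi)^a, at the point x *)
Definition Delta (R : realType) (p : 'rV[R]_2 -> R) (lambda mu nu : 'rV[R]_5 -> R)
    (psi : 'rV[R]_4 -> 'rV[R]_5) (a : 'I_5) (x : 'rV[R]_4) : R :=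
  \sum_(be < 4) \sum_(c < 5)
    Sup p lambda mu nu a be c (psi x) * partial be (fun y => psi y 0 c) x.

Definition Btilde (R : realType) (p : 'rV[R]_2 -> R) (lambda mu nu : 'rV[R]_5 -> R)
    (B : 'I_5 -> 'I_4 -> 'I_5 -> 'I_4 -> 'rV[R]_5 -> R)
    (a : 'I_5) (be : 'I_4) (c : 'I_5) (de : 'I_4) (psi : 'rV[R]_5) : R :=
  B a be c de psi
    + \sum_(f < 5) partial f (T p a be) psi * Slow p lambda mu nu f de c psi.

Definition values_in_compact (R : realType) (D : set 'rV[R]_5) (eps0 : R)
    (Om : set 'rV[R]_4) (psi : R -> 'rV[R]_4 -> 'rV[R]_5) : Prop :=
  exists K : set 'rV[R]_5, [/\ compact K, K `<=` D &
    forall eps x, 0 < eps <= eps0 -> Om x -> K (psi eps x)].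

Definition bounded_smooth_family (R : realType) (D : set 'rV[R]_5) (eps0 : R)
    (Om : set 'rV[R]_4) (psi : R -> 'rV[R]_4 -> 'rV[R]_5) : Prop :=
  [/\ values_in_compact D eps0 Om psi,
      (forall eps (c : 'I_5), 0 < eps <= eps0 ->
         smooth_on Om (fun x => psi eps x 0 c)) &
      (forall (c : 'I_5) (s : seq 'I_4), exists M : R, forall eps x,
         0 < eps <= eps0 -> Om x ->
         `|ipartial s (fun y => psi eps y 0 c) x| <= M)].

(* Main.v *)
Require Import Defs.
From mathcomp Require Import all_boot all_order all_algebra.
From mathcomp Require Import all_classical all_reals all_analysis.
From mathcomp Require Import ring lra.
Set Implicit Arguments.
Unset Strict Implicit.
Unset Printing Implicit Defensive.
Import Order.TTheory GRing.Theory Num.Theory.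
Import numFieldNormedType.Exports.
Local Open Scope classical_set_scope.
Local Open Scope ring_scope.

(** Write [w] for the given family, [u = w + eps Delta] for its shift and
    [h_f = u_f - w_f], all indices lowered.  By definition of the modified
    coefficients, the difference of the two fluxes is exactly

      [T(u) - T(w) - sum_f d_f T(w) h_f]
        [+ eps (sum (B(u) - B(w)) du + sum B(w) dh)],

    because [eps d_f T S_f dw] is [d_f T h_f].  If [h] is O(eps^k), the first
    bracket is a Taylor remainder, hence O(eps^(2k)), and the second line is
    O(eps^(k+1)).  Thus it is enough that [h] is O(eps^2), that is, that
    [Delta] is O(eps).

    This is where the special form of [S] enters: by the chain rule [Delta^a]
    is [C^a_b] times the divergence of the ideal tensor [T^b(w)]
    ([Delta_ideal_div]).  If [w] solves the second system, this divergence
    equals [- eps] times the divergence of a gradient form and is O(eps)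
    ([isO_ideal_div]).  If instead [u] solves the first system, the same
    argument applies to the divergence of [T(u)]; as [h] is O(eps) in any case,
    [T(u)] and [T(w)] differ by O(eps) ([isO_ideal_div_sub]). 

    The rest is analysis.  O(eps^k) bounds all derivatives, so three facts on
    composite families with values in a compact subset of an open set are
    needed: [F(u)] is bounded ([isO_comp]), [F(u) - F(w)] is of the order of
    [h] ([isO_comp_sub]), and the first-order Taylor remainder is of the order
    of [h^2] ([isO_comp_taylor]).  Each is proved by induction on the number of
    derivatives, for all smooth [F] at once: differentiating the quantity gives
    the same quantity for the partial derivatives of [F], times bounded
    factors, plus terms that are already controlled.  For the Taylor remainder
    this uses the symmetry of second derivatives ([partialC]).  There remain
    estimates without derivatives, the Lipschitz and Taylor inequalities on a
    compact set.  Two points of that set need not be joined by a segment inside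
    the domain of [F], so these inequalities are proved near the diagonal by
    the mean value theorem and extended by compactness
    ([compact_pair_bound]). *)

(** * Differential calculus in coordinates *)

(** Differentiability depends on the germ only: the differential of a function
    that vanishes near [x] is zero, and any other function is reached by adding one
    of these. *)
Lemma differentiable_near0 (R : realType) (V W : normedModType R)
    (d : V -> W) (x : V) : (\near x, d x = 0) -> differentiable d x.
Proof.
move=> d0.
have E : d \o shift x = cst (d x) + \0 +o_ 0 id.
  apply/eqaddoP => e e0 /=.
  have := d0; rewrite (near_shift 0) => d0'.
  near=> y; rewrite /= !fctE (nbhs_singleton d0) addr0 subr0.
  have -> : d (y + x) = 0.
    near: y; move: d0'; apply: filterS => y /=; by rewrite subr0.
  by rewrite normr0 mulr_ge0// ltW.
have c0 : continuous (\0 : V -> W) by move=> y; exact: cvg_cst.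
have D := diff_unique c0 E.
by apply/diff_locallyP; rewrite D.
Unshelve. all: by end_near. Qed.

Lemma near_eq_differentiable (R : realType) (V W : normedModType R)
    (f g : V -> W) (x : V) :
  (\near x, f x = g x) -> differentiable f x -> differentiable g x.
Proof.
move=> fg df; rewrite (_ : g = f + (g - f)); last by rewrite addrC subrK.
apply: differentiableD => //; apply: differentiable_near0.
by move: fg; apply: filterS => y /= fgy; rewrite !fctE fgy subrr.
Qed.

Lemma differentiable_row (R : realType) (V : normedModType R) (n : nat)
    (u : V -> 'rV[R]_n) (x : V) :
  (forall c, differentiable (fun y => u y 0 c) x) -> differentiable u x.
Proof.
move=> du; rewrite (_ : u = \sum_(c < n) (fun y => u y 0 c *: delta_mx 0 c)).
  by apply: differentiable_sum => c; exact: differentiableZl.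
by apply/funext => y; rewrite fct_sumE -row_sum_delta.
Qed.

Lemma diff_row_coord (R : realType) (V : normedModType R) (n : nat)
    (u : V -> 'rV[R]_n) (x v : V) (c : 'I_n) :
  differentiable u x -> ('d u x v) 0 c = 'd (fun y => u y 0 c) x v.
Proof.
move=> du.
have dc : differentiable (fun y => u y 0 c) x.
  by apply: (@differentiable_comp _ _ _ _ u (fun N : 'rV[R]_n => N 0 c)) => //;
     exact: differentiable_coord.
rewrite -!deriveE// derive_mx ?mxE//; exact: diff_derivable.
Qed.

Lemma diff_sum_partial (R : realType) (n : nat) (F : 'rV[R]_n -> R)
    (x v : 'rV[R]_n) : differentiable F x ->
  'd F x v = \sum_(f < n) partial f F x * v 0 f.
Proof.
move=> dF; rewrite [in LHS](row_sum_delta v) linear_sum; apply: eq_bigr => f _.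
by rewrite linearZ /partial deriveE// mulrC.
Qed.

Lemma derive_comp_row (R : realType) (V : normedModType R) (n : nat)
    (u : V -> 'rV[R]_n) (F : 'rV[R]_n -> R) (x v : V) :
  differentiable u x -> differentiable F (u x) ->
  'D_v (F \o u) x = \sum_(f < n) partial f F (u x) * 'D_v (fun y => u y 0 f) x.
Proof.
move=> du dF.
have dc c : differentiable (fun y => u y 0 c) x.
  by apply: (@differentiable_comp _ _ _ _ u (fun N : 'rV[R]_n => N 0 c)) => //;
     exact: differentiable_coord.
rewrite deriveE; last exact: differentiable_comp.
rewrite diff_comp//= diff_sum_partial//; apply: eq_bigr => f _.
by rewrite diff_row_coord// deriveE.
Qed.

(** * Smooth functions on an open set *)

Lemma near_open (R : realType) (n : nat) (A : set 'rV[R]_n) (P : 'rV[R]_n -> Prop) x :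
  open A -> A x -> (forall y, A y -> P y) -> \near x, P x.
Proof. by move=> oA Ax AP; apply: filterS AP _; exact: open_nbhs_nbhs. Qed.

Lemma partial_ext (R : realType) (n : nat) (A : set 'rV[R]_n) (i : 'I_n)
    (f g : 'rV[R]_n -> R) : open A -> {in A, f =1 g} ->
  {in A, partial i f =1 partial i g}.
Proof.
move=> oA fg x /set_mem Ax; apply: near_eq_derive; apply: (near_open oA Ax) => y Ay.
by apply: fg; exact: mem_set.
Qed.

Lemma ipartial_rcons (R : realType) (n : nat) (s : seq 'I_n) (i : 'I_n)
    (f : 'rV[R]_n -> R) : ipartial (rcons s i) f = ipartial s (partial i f).
Proof. by rewrite /ipartial foldr_rcons. Qed.

(** Smoothness graded by the number of derivatives.  For products and
    composites, the derivative involves the function itself again, so closure can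
    only be proved one order at a time, for all functions simultaneously; the list
    of derivatives in [smooth_on] does not give such an induction directly. *)
Fixpoint smooth_upto (N : nat) (R : realType) (n : nat) (A : set 'rV[R]_n)
    (f : 'rV[R]_n -> R) : Prop :=
  (forall x, A x -> differentiable f x) /\
  (if N is N'.+1 then forall i, smooth_upto N' A (partial i f) else True).

Lemma smooth_upto_diff N (R : realType) (n : nat) (A : set 'rV[R]_n) f x :
  smooth_upto N A f -> A x -> differentiable f x.
Proof. by case: N => [|N] [+ _]; apply. Qed.

Lemma smooth_upto_pred N (R : realType) (n : nat) (A : set 'rV[R]_n) f :
  smooth_upto N.+1 A f -> smooth_upto N A f.
Proof.
elim: N f => [|N IH] f [df pf]; split=> // i; exact: IH.
Qed.

Lemma smooth_onP (R : realType) (n : nat) (A : set 'rV[R]_n) f :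
  smooth_on A f <-> forall N, smooth_upto N A f.
Proof.
split=> [sf N|Cf s].
  elim: N f sf => [|N IH] f sf; split=> //; try exact: (sf [::]).
  by move=> i; apply: IH => s x; rewrite -ipartial_rcons; exact: sf.
elim/last_ind: s f Cf => [|s i IH] f Cf x Ax; first exact: smooth_upto_diff (Cf 0%N) Ax.
by rewrite ipartial_rcons; apply: IH => // N; have [_] := Cf N.+1; exact.
Qed.

Lemma smooth_diff (R : realType) (n : nat) (A : set 'rV[R]_n) f x :
  smooth_on A f -> A x -> differentiable f x.
Proof. by move=> sf; exact: (sf [::]). Qed.

Lemma smooth_partial (R : realType) (n : nat) (A : set 'rV[R]_n) f i :
  smooth_on A f -> smooth_on A (partial i f).
Proof. by move=> sf s x Ax; rewrite -ipartial_rcons; exact: sf. Qed.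

Lemma smooth_upto_ext N (R : realType) (n : nat) (A : set 'rV[R]_n) f g : open A ->
  {in A, f =1 g} -> smooth_upto N A f -> smooth_upto N A g.
Proof.
move=> oA; have D f' g' : {in A, f' =1 g'} -> (forall x, A x -> differentiable f' x) ->
    forall x, A x -> differentiable g' x.
  move=> fg df x Ax; apply: near_eq_differentiable (df x Ax).
  by apply: (near_open oA Ax) => y Ay; apply: fg; exact: mem_set.
elim: N f g => [|N IH] f g fg [df pf]; split=> //; try exact: D fg df.
by move=> i; apply: IH (pf i); exact: partial_ext.
Qed.

Lemma smooth_ext (R : realType) (n : nat) (A : set 'rV[R]_n) f g : open A ->
  {in A, f =1 g} -> smooth_on A f -> smooth_on A g.
Proof. by move=> oA fg /smooth_onP sf; apply/smooth_onP => N; exact: smooth_upto_ext (sf N). Qed.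

Lemma smooth_subset (R : realType) (n : nat) (A A' : set 'rV[R]_n) f :
  A' `<=` A -> smooth_on A f -> smooth_on A' f.
Proof. by move=> AA sf s x /AA; exact: sf. Qed.

Lemma partialD (R : realType) (n : nat) (f g : 'rV[R]_n -> R) i x :
  differentiable f x -> differentiable g x ->
  partial i (fun y => f y + g y) x = partial i f x + partial i g x.
Proof. by move=> df dg; apply: deriveD; exact: diff_derivable. Qed.

Lemma partialM (R : realType) (n : nat) (f g : 'rV[R]_n -> R) i x :
  differentiable f x -> differentiable g x ->
  partial i (fun y => f y * g y) x = partial i f x * g x + f x * partial i g x.
Proof.
move=> df dg; rewrite /partial deriveM; [|exact: diff_derivable..].
by rewrite addrC; congr (_ + _); rewrite [LHS]mulrC.
Qed.

Lemma smooth_upto_add N (R : realType) (n : nat) (A : set 'rV[R]_n) f g : open A ->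
  smooth_upto N A f -> smooth_upto N A g -> smooth_upto N A (fun y => f y + g y).
Proof.
move=> oA; elim: N f g => [|N IH] f g [df pf] [dg pg];
  (split; first by move=> x Ax; exact: differentiableD (df x Ax) (dg x Ax)) => //.
move=> i; apply: (smooth_upto_ext oA _ (IH _ _ (pf i) (pg i))) => x /set_mem Ax.
by rewrite partialD//; [exact: df|exact: dg].
Qed.

Lemma smooth_upto_mul N (R : realType) (n : nat) (A : set 'rV[R]_n) f g : open A ->
  smooth_upto N A f -> smooth_upto N A g -> smooth_upto N A (fun y => f y * g y).
Proof.
move=> oA; elim: N f g => [|N IH] f g Cf Cg;
  (split; first by move=> x Ax; apply: differentiableM;
     [exact: smooth_upto_diff Cf Ax|exact: smooth_upto_diff Cg Ax]) => //.
move=> i; have [pf pg] := (Cf.2 i, Cg.2 i).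
apply: (smooth_upto_ext oA _ (smooth_upto_add oA (IH _ _ pf (smooth_upto_pred Cg)) (IH _ _ (smooth_upto_pred Cf) pg))).
move=> x /set_mem Ax.
by rewrite partialM//; [exact: smooth_upto_diff Cf Ax|exact: smooth_upto_diff Cg Ax].
Qed.

Lemma smooth_add (R : realType) (n : nat) (A : set 'rV[R]_n) f g : open A ->
  smooth_on A f -> smooth_on A g -> smooth_on A (fun y => f y + g y).
Proof.
by move=> oA /smooth_onP sf /smooth_onP sg; apply/smooth_onP => N; exact: smooth_upto_add.
Qed.

Lemma smooth_mul (R : realType) (n : nat) (A : set 'rV[R]_n) f g : open A ->
  smooth_on A f -> smooth_on A g -> smooth_on A (fun y => f y * g y).
Proof.
by move=> oA /smooth_onP sf /smooth_onP sg; apply/smooth_onP => N; exact: smooth_upto_mul.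
Qed.

Lemma partial_cst (R : realType) (n : nat) (c : R) (i : 'I_n) :
  partial i (fun _ => c) = (fun _ => 0).
Proof. by apply/funext => x; exact: derive_cst. Qed.

Lemma partial_sum (R : realType) (n : nat) (I : Type) (r : seq I) (q : I -> 'rV[R]_n -> R) i x :
  (forall j, differentiable (q j) x) ->
  partial i (fun y => \sum_(j <- r) q j y) x = \sum_(j <- r) partial i (q j) x.
Proof.
move=> dq; suff [_ ->] : differentiable (fun y => \sum_(j <- r) q j y) x /\
  partial i (fun y => \sum_(j <- r) q j y) x = \sum_(j <- r) partial i (q j) x by [].
elim: r => [|j r [dr IH]].
  under eq_fun do rewrite big_nil; rewrite big_nil partial_cst.
  by split=> //; exact: differentiable_cst.
under eq_fun do rewrite big_cons; rewrite big_cons partialD// IH.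
by split=> //; exact: differentiableD.
Qed.

Lemma ipartial_cst (R : realType) (n : nat) (c : R) (s : seq 'I_n) :
  ipartial s (fun _ => c) = (fun _ => if s is [::] then c else 0).
Proof.
by elim: s => //= i s ->; rewrite partial_cst.
Qed.

Lemma smooth_cst (R : realType) (n : nat) (A : set 'rV[R]_n) (c : R) :
  smooth_on A (fun _ => c).
Proof. by move=> s x _; rewrite ipartial_cst; exact: differentiable_cst. Qed.

Lemma smooth_sum (R : realType) (n : nat) (A : set 'rV[R]_n) (I : Type)
    (r : seq I) (f : I -> 'rV[R]_n -> R) : open A ->
  (forall j, smooth_on A (f j)) -> smooth_on A (fun y => \sum_(j <- r) f j y).
Proof.
move=> oA sf; elim: r => [|j r IH].
  by under eq_fun do rewrite big_nil; exact: smooth_cst.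
by under eq_fun do rewrite big_cons; exact: smooth_add.
Qed.

Lemma smooth_coord (R : realType) (n : nat) (A : set 'rV[R]_n) (c : 'I_n) :
  smooth_on A (fun y => y 0 c).
Proof.
apply/smooth_onP; case=> [|N]; (split; first by move=> x _; exact: differentiable_coord) => // i.
rewrite (_ : partial i _ = fun _ => (delta_mx 0 i : 'rV[R]_n) 0 c).
  by move: N; apply/smooth_onP; exact: smooth_cst.
apply/funext => x; rewrite /partial.
have := @derive_mx R _ 1 n id x (delta_mx 0 i : 'rV[R]_n) (@derivable_id _ _ _ _).
by rewrite derive_id => {2}->; rewrite mxE.
Qed.

Lemma smooth_opp (R : realType) (n : nat) (A : set 'rV[R]_n) f : open A ->
  smooth_on A f -> smooth_on A (fun y => - f y).
Proof.
move=> oA sf; have := smooth_mul oA (smooth_cst (A:=A) (-1)) sf.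
by under eq_fun do rewrite mulN1r.
Qed.

(** The derivative of an inverse is a polynomial in the inverse and the
    derivative of the function, so each order of smoothness yields the next one. *)
Lemma smooth_inv (R : realType) (n : nat) (A : set 'rV[R]_n) f : open A ->
  (forall x, A x -> f x != 0) -> smooth_on A f -> smooth_on A (fun y => (f y)^-1).
Proof.
move=> oA f0 sf.
have df x : A x -> differentiable (fun y => (f y)^-1) x.
  by move=> Ax; apply: differentiableV (f0 x Ax); exact: smooth_diff sf Ax.
apply/smooth_onP; elim => [|N IH]; split=> // i.
have C1 : smooth_upto N A (fun y => - partial i f y).
  by move: N {IH}; apply/smooth_onP; apply: smooth_opp => //; exact: smooth_partial.
apply: (smooth_upto_ext oA _ (smooth_upto_mul oA C1 (smooth_upto_mul oA IH IH))) => x /set_mem Ax.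
rewrite /partial deriveV ?f0//; last exact/diff_derivable/(smooth_diff sf).
by rewrite -invfM -expr2 mulNr mulrC -mulNr.
Qed.

(** Induction on the order, for all outer functions at once, since the chain rule
    replaces [F] by its partial derivatives. *)
Lemma smooth_comp (R : realType) (n m : nat) (A : set 'rV[R]_n) (D : set 'rV[R]_m)
    (u : 'rV[R]_n -> 'rV[R]_m) (F : 'rV[R]_m -> R) : open A ->
  (forall x, A x -> D (u x)) -> (forall c, smooth_on A (fun y => u y 0 c)) ->
  smooth_on D F -> smooth_on A (F \o u).
Proof.
move=> oA uD su sF; apply/smooth_onP => N.
have du x : A x -> differentiable u x.
  by move=> Ax; apply: differentiable_row => c; exact: smooth_diff (su c) Ax.
elim: N F sF => [|N IH] F sF; (split; first by move=> x Ax;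
  apply: differentiable_comp (du x Ax) _; exact: smooth_diff sF (uD x Ax)) => // i.
have CS (r : seq 'I_m) : smooth_upto N A (fun y => \sum_(f <- r)
      partial f F (u y) * partial i (fun z => u z 0 f) y).
    elim: r => [|f r IHr].
      under eq_fun do rewrite big_nil; move: N {IH}.
      by apply/smooth_onP; exact: smooth_cst.
    under eq_fun do rewrite big_cons; apply: smooth_upto_add => //; apply: smooth_upto_mul => //.
      by apply: (IH (partial f F)); exact: smooth_partial.
    by move: N {IH IHr}; apply/smooth_onP; exact: smooth_partial.
  apply: (smooth_upto_ext oA _ (CS _)) => x /set_mem Ax; rewrite /partial derive_comp_row//.
    exact: du.
  exact: smooth_diff sF (uD x Ax).
Qed.

(** * Mean value estimates *)

Lemma normr_coord_le (R : realType) (n : nat) (v : 'rV[R]_n) (c : 'I_n) :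
  `|v 0 c| <= `|v|.
Proof.
rewrite [leRHS]/Num.Def.normr/= mx_normrE.
exact: (le_bigmax _ (fun ij : 'I_1 * 'I_n => `|v ij.1 ij.2|) (0, c)).
Qed.

Lemma normr_row_le (R : realType) (n : nat) (v : 'rV[R]_n) (b : R) :
  0 <= b -> (forall c, `|v 0 c| <= b) -> `|v| <= b.
Proof.
move=> b0 vb; rewrite [leLHS]/Num.Def.normr/= mx_normrE.
by apply: bigmax_le => // -[i j] _ /=; rewrite (ord1 i).
Qed.

(** A ball is convex, so the scalar mean value theorem applies along the segment
    from [v] to [u]. *)
Lemma mvt_ball (R : realType) (n : nat) (F : 'rV[R]_n -> R) (x u v : 'rV[R]_n) (r : R) :
  (forall y, ball x r y -> differentiable F y) -> ball x r u -> ball x r v ->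
  exists2 t : R, 0 <= t <= 1 & ball x r (v + t *: (u - v)) /\
    F u - F v = \sum_(f < n) partial f F (v + t *: (u - v)) * (u - v) 0 f.
Proof.
move=> dF xu xv.
pose c (t : R^o) : 'rV[R]_n := v + t *: (u - v).
have ballc t : 0 <= t <= 1 -> ball x r (c t).
  move=> /andP[t0 t1]; move: xu xv; rewrite -ball_normE /= => xu xv.
  rewrite (_ : x - c t = t *: (x - u) + (1 - t) *: (x - v)); last first.
    apply/rowP => i; rewrite !mxE; ring.
  apply: le_lt_trans (ler_normD _ _) _; rewrite !normrZ !ger0_norm ?subr_ge0//.
  have [->|tn0] := eqVneq t 0; first by rewrite mul0r subr0 mul1r add0r.
  have tp : 0 < t by rewrite lt_neqAle eq_sym tn0.
  have -> : r = t * r + (1 - t) * r by ring.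
  by rewrite ltr_leD// ?ltr_pM2l// ler_wpM2l ?subr_ge0// ltW.
have dc (t : R^o) : is_derive t (1 : R^o) c (u - v).
  have dcD : is_diff t (cst v + *:%R^~ (u - v)) (0 + *:%R^~ (u - v)).
    exact: is_diffD.
  rewrite (_ : c = cst v + *:%R^~ (u - v)); last exact: funext.
  apply: DeriveDef.
    by apply: diff_derivable; exact: ex_diff.
  by rewrite deriveE ?diff_val; [rewrite /= add0r scale1r|exact: ex_diff].
have dFc (t : R^o) : 0 <= t <= 1 ->
    is_derive (t : R^o) (1 : R^o) (F \o c) (\sum_(f < n) partial f F (c t) * (u - v) 0 f).
  move=> t01; have dct : differentiable c t by apply/derivable1_diffP.
  have dFt := dF _ (ballc t t01).
  apply: DeriveDef.
    by apply: diff_derivable; exact: differentiable_comp.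
  rewrite derive_comp_row//; apply: eq_bigr => f _; congr (_ * _).
  have := @derive_mx _ _ 1 n c t 1 (@ex_derive _ _ _ _ _ _ _ (dc t)).
  by rewrite derive_val => ->; rewrite mxE.
have [||t t01 E] := @MVT_segment R (F \o c)
    (fun t => \sum_(f < n) partial f F (c t) * (u - v) 0 f) 0 1 ler01.
- move=> t; rewrite in_itv /= => /andP[t0 t1]; apply: dFc.
  by rewrite !ltW.
- apply: derivable_within_continuous => t; rewrite in_itv /= => t01.
  exact: (@ex_derive _ _ _ _ _ _ _ (dFc t t01)).
exists t => //; split; first exact: ballc.
by move: E; rewrite /= /c scale0r addr0 scale1r subrKC subr0 mulr1.
Qed.

Lemma near_ball_sub (R : realType) (n : nat) (x : 'rV[R]_n) (P : 'rV[R]_n -> Prop) :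
  (\near x, P x) -> exists2 r : R, 0 < r & forall y, ball x r y -> P y.
Proof. by move=> /nbhs_ballP[r /= r0 rP]; exists r. Qed.

Lemma smooth_continuous (R : realType) (n : nat) (D : set 'rV[R]_n) F x :
  smooth_on D F -> D x -> {for x, continuous F}.
Proof. by move=> sF Dx; apply: differentiable_continuous; exact: smooth_diff sF Dx. Qed.

Lemma smooth_near (R : realType) (n : nat) (D : set 'rV[R]_n) F x (e : R) :
  smooth_on D F -> D x -> 0 < e -> \forall y \near x, `|F x - F y| < e.
Proof.
by move=> sF Dx e0; move/cvgrPdist_lt : (smooth_continuous sF Dx); apply.
Qed.

Lemma lipschitz_near (R : realType) (n : nat) (D : set 'rV[R]_n) F x :
  open D -> smooth_on D F -> D x ->
  exists r M : R, 0 < r /\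
    forall u v, ball x r u -> ball x r v -> `|F u - F v| <= M * `|u - v|.
Proof.
move=> oD sF Dx.
have : \forall y \near x, D y /\ (forall f, `|partial f F x - partial f F y| < 1).
  near=> y; split; first by near: y; exact: open_nbhs_nbhs.
  by near: y; apply: filter_forall => f; exact: smooth_near (smooth_partial f sF) Dx ltr01.
move=> /near_ball_sub[r r0 rP].
exists r, (\sum_(f < n) (`|partial f F x| + 1)); split=> // u v xu xv.
have [|t _ [xc ->]] := @mvt_ball R n F x u v r _ xu xv.
  by move=> y /rP[Dy _]; exact: smooth_diff sF Dy.
apply: le_trans (ler_norm_sum _ _ _) _; rewrite mulr_suml.
apply: ler_sum => f _; rewrite normrM ler_pM// ?normr_coord_le//.
have [_ /(_ f) /ltW h] := rP _ xc.
rewrite -[X in `|X|](subrK (partial f F x)) addrC.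
by apply: le_trans (ler_normD _ _) _; rewrite lerD2l distrC.
Unshelve. all: by end_near. Qed.

(** One mean value theorem is enough: it writes [F u - F v] with the gradient at
    an intermediate point, and the gradient is Lipschitz. *)
Lemma taylor_near (R : realType) (n : nat) (D : set 'rV[R]_n) F x :
  open D -> smooth_on D F -> D x ->
  exists r M : R, 0 < r /\
    forall u v, ball x r u -> ball x r v ->
    `|F u - F v - \sum_(f < n) partial f F v * (u - v) 0 f| <= M * `|u - v| ^+ 2.
Proof.
move=> oD sF Dx.
have /choice[rM rMP] : forall f, exists rM : R * R, 0 < rM.1 /\
    forall u v, ball x rM.1 u -> ball x rM.1 v ->
    `|partial f F u - partial f F v| <= rM.2 * `|u - v|.
  move=> f; have [r [M H]] := lipschitz_near oD (smooth_partial f sF) Dx.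
  by exists (r, M).
have : \forall y \near x, D y /\ (forall f, ball x (rM f).1 y).
  near=> y; split; first by near: y; exact: open_nbhs_nbhs.
  near: y; apply: filter_forall => f; apply: nbhsx_ballx.
  by have [] := rMP f.
move=> /near_ball_sub[r r0 rP].
exists r, (\sum_(f < n) (rM f).2); split=> // u v xu xv.
have [|t /andP[t0 t1] [xc ->]] := @mvt_ball R n F x u v r _ xu xv.
  by move=> y /rP[Dy _]; exact: smooth_diff sF Dy.
rewrite -sumrB; apply: le_trans (ler_norm_sum _ _ _) _; rewrite mulr_suml.
apply: ler_sum => f _; rewrite -mulrBl normrM expr2 mulrA.
rewrite ler_pM// ?normr_coord_le//.
have [_ /(_ _ _ ((rP _ xc).2 f) ((rP _ xv).2 f)) h] := rMP f.
apply: le_trans h _; rewrite addrC addKr normrZ ger0_norm//.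
(* A Lipschitz constant is nonnegative as soon as it is used for two distinct
   points. *)
have M0 : 0 <= (rM f).2 \/ u = v.
  have [->|uv] := eqVneq u v; [by right|left].
  have [_ /(_ _ _ ((rP _ xu).2 f) ((rP _ xv).2 f)) h] := rMP f.
  have uv0 : 0 < `|u - v| by rewrite normr_gt0 subr_eq0.
  by rewrite -(pmulr_lge0 _ uv0); exact: le_trans (normr_ge0 _) h.
case: M0 => [M0|->]; last by rewrite subrr normr0 !mulr0.
by rewrite ler_wpM2l// ler_piMl.
Unshelve. all: by end_near. Qed.

Lemma partial_shift (R : realType) (n : nat) (F : 'rV[R]_n -> R) (w : 'rV[R]_n) i x :
  partial i (fun y => F (y + w)) x = partial i F (x + w).
Proof.
rewrite /partial /derive /=.
by under [X in lim (X @ _) = _]eq_fun do rewrite -addrA.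
Qed.

Lemma differentiable_shift (R : realType) (n : nat) (F : 'rV[R]_n -> R) (w : 'rV[R]_n) x :
  differentiable F (x + w) -> differentiable (fun y => F (y + w)) x.
Proof.
move=> dF; apply: (@differentiable_comp _ _ _ _ (fun y => y + w) F) => //.
Qed.

Lemma norm_delta_le (R : realType) (n : nat) (i : 'I_n) :
  `|delta_mx 0 i : 'rV[R]_n| <= 1.
Proof.
apply: normr_row_le => // c; rewrite mxE eqxx /=.
by case: (_ == _); rewrite ?normr1// normr0.
Qed.

(** Two successive mean value theorems: the first one in direction [i], for the
    increment of [F] in direction [j], the second one for [partial i F]. *)
Lemma second_difference (R : realType) (n : nat) (D : set 'rV[R]_n) F x i j (r t : R) :
  smooth_on D F -> ball x r `<=` D -> 0 < t -> 2 * t < r ->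
  exists2 y, ball x r y &
  F (x + t *: delta_mx 0 i + t *: delta_mx 0 j) - F (x + t *: delta_mx 0 i)
    - (F (x + t *: delta_mx 0 j) - F x) = t ^+ 2 * partial j (partial i F) y.
Proof.
move=> sF xD t0 tr.
set ei := t *: _; set ej := t *: delta_mx 0 j.
have nd (k : 'I_n) (s : R) : 0 <= s -> `|s *: (delta_mx 0 k : 'rV[R]_n)| <= s.
  move=> s0; rewrite normrZ ger0_norm// -[leRHS]mulr1 ler_wpM2l//.
  exact: norm_delta_le.
have bx (w : 'rV[R]_n) s : `|w| < s -> ball x s (x + w).
  by move=> ws; rewrite -ball_normE /= opprD addNKr normrN.
have sum_e (G : 'I_n -> R) (k : 'I_n) (v : 'rV[R]_n) :
    \sum_(f < n) G f * (v + t *: delta_mx 0 k - v) 0 f = t * G k.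
  rewrite addrC addKr (bigD1 k)//= big1 => [|f fk].
    by rewrite !mxE !eqxx mulr1 addr0 mulrC.
  by rewrite !mxE eqxx (negbTE fk) !mulr0.
have bej (y : 'rV[R]_n) : ball x (r - t) y -> ball x r (y + ej).
  rewrite -!ball_normE /= => xy; rewrite opprD addrA.
  apply: le_lt_trans (ler_normB _ _) _.
  by rewrite -ltrBrDr; apply: lt_le_trans xy _; rewrite lerB// nd// ltW.
have bsub (y : 'rV[R]_n) : ball x (r - t) y -> ball x r y.
  by apply: le_ball; rewrite gerBl ltW.
have [||| s s01 [b1 E1]] := @mvt_ball R n (fun y => F (y + ej) - F y) x (x + ei) x (r - t).
- move=> y xy; apply: differentiableB.
    by apply: differentiable_shift; apply: smooth_diff sF _; apply: xD; exact: bej.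
  by apply: smooth_diff sF _; apply: xD; exact: bsub.
- by apply: bx; apply: le_lt_trans (nd _ _ (ltW t0)) _; lra.
- by apply: ballxx; lra.
set z := x + s *: _ in b1 E1.
have [||| s' s01' [b2 E2]] := @mvt_ball R n (partial i F) x (z + ej) z r.
- move=> y xy; apply: (smooth_diff (smooth_partial i sF)); exact: xD.
- exact: bej.
- exact: bsub.
exists (z + s' *: (z + ej - z)) => //.
rewrite E1 sum_e expr2 -mulrA; congr (_ * _).
rewrite -(sum_e (fun f => partial f (partial i F) (z + s' *: (z + ej - z))) j z) -E2.
rewrite -partial_shift; apply: (@deriveB _ _ _ (fun y => F (y + ej)) F z).
  apply: diff_derivable; apply: differentiable_shift; apply: smooth_diff sF _.
  by apply: xD; exact: bej.
by apply: diff_derivable; apply: smooth_diff sF _; apply: xD; exact: bsub.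
Qed.

(** The second difference is symmetric in the two directions.  Dividing it by
    [t^2] and using continuity, both mixed derivatives are its limit at [x]. *)
Lemma partialC (R : realType) (n : nat) (D : set 'rV[R]_n) F x i j :
  open D -> smooth_on D F -> D x ->
  partial i (partial j F) x = partial j (partial i F) x.
Proof.
have swap4 (A B C X : R) : A - B - (C - X) = A - C - (B - X) by ring.
have tr (r : R) : 0 < r -> 2 * (r / 3) < r by lra.
move=> oD sF Dx; apply/eqP; rewrite -subr_eq0 -normr_eq0; apply/negP => /negP ne.
set a := partial i _ _ in ne; set b := partial j _ _ in ne.
have e0 : 0 < `|a - b| / 2 by rewrite divr_gt0// lt_neqAle eq_sym ne normr_ge0.
have nD : \forall y \near x, D y by exact: open_nbhs_nbhs.
have na := smooth_near (smooth_partial i (smooth_partial j sF)) Dx e0.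
have nb := smooth_near (smooth_partial j (smooth_partial i sF)) Dx e0.
have [r r0 rP] := near_ball_sub (filterI nD (filterI na nb)).
have xD : ball x r `<=` D by move=> y /rP[].
(* Two steps of length [r / 3] stay inside the ball. *)
have t0 : 0 < r / 3 by rewrite divr_gt0.
have {}tr := tr _ r0.
have [y /rP[_ [_ yb]] Ey] := second_difference i j sF xD t0 tr.
have [z /rP[_ [za _]] Ez] := second_difference j i sF xD t0 tr.
have E : partial j (partial i F) y = partial i (partial j F) z.
  apply: (@mulfI _ ((r / 3) ^+ 2)); first by rewrite expf_neq0// gt_eqF.
  apply: (etrans (esym Ey)); apply: (etrans _ Ez); apply: (etrans (swap4 _ _ _ _)).
  by congr (F _ - _ - _); exact: addrAC.
rewrite E in yb.
move: na nb za yb {rP Ey Ez E}; move: (partial i (partial j F) z) => w _ _ za yb.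
have := le_lt_trans (ler_normB (a - w) (b - w)) (ltrD za yb).
by rewrite opprB addrA subrK -splitr ltxx.
Qed.

(** * From local to uniform estimates on a compact set *)

(** Local bounds on a compact set have a common one, as the admissible bounds form
    an upward closed set. *)
Lemma compact_bound (R : realType) (T : topologicalType) (K : set T)
    (P : R -> T -> Prop) : compact K ->
  (forall M M' x, M <= M' -> P M x -> P M' x) ->
  (forall x, K x -> exists M, \forall y \near x, P M y) ->
  exists M, forall x, K x -> P M x.
Proof.
move=> /compact_near_coveringP cK mono loc.
have : \forall M \near +oo, K `<=` P M.
  apply: (cK R (pinfty_nbhs R) P _) => x /loc[M PM].
  exists ([set y | P M y], [set M' | M <= M']) => /=.
    by split=> //; exact: nbhs_pinfty_ge (num_real M).
  by move=> [y M'] /= [Py MM']; exact: mono Py.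
by move=> /pinfty_ex_gt0[M _ KM]; exists M.
Qed.

(** Apply [compact_bound] on the square of [K].  The hypothesis covers the points
    of the diagonal; off the diagonal [u - v] stays away from zero, and continuity
    of [Phi] suffices. *)
Lemma compact_pair_bound (R : realType) (n k : nat) (K : set 'rV[R]_n)
  (Phi : 'rV[R]_n -> 'rV[R]_n -> R) : compact K ->
  (forall x, K x -> exists r M : R, 0 < r /\
    forall u v, ball x r u -> ball x r v -> `|Phi u v| <= M * `|u - v| ^+ k) ->
  (forall u v, K u -> K v -> {for (u, v), continuous (fun z => Phi z.1 z.2)}) ->
  exists M, forall u v, K u -> K v -> `|Phi u v| <= M * `|u - v| ^+ k.
Proof.
move=> cK diag cPhi.
have := @compact_bound R _ (K `*` K)
   (fun M z => `|Phi z.1 z.2| <= M * `|z.1 - z.2| ^+ k) (compact_setX cK cK).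
case.
- move=> M M' z MM'; move/le_trans; apply; rewrite ler_wpM2r// exprn_ge0//.
- move=> [u v] [/= Ku Kv]; have [<-|uv] := eqVneq u v.
    have [r [M [r0 rP]]] := diag _ Ku.
    exists M; exists (ball u r, ball u r) => /=.
      by split; exact: nbhsx_ballx.
    by move=> [u' v'] /= [bu bv]; exact: rP.
  set d := `|u - v|; have d0 : 0 < d by rewrite normr_gt0 subr_eq0.
  have cn : {for (u, v), continuous (fun z : 'rV[R]_n * 'rV[R]_n => `|z.1 - z.2|)}.
    by apply: cvg_norm; apply: cvgB; [exact: cvg_fst|exact: cvg_snd].
  (* Near [(u, v)] the absolute value of [Phi] grows by at most 1, and the distance
     of the two points stays above [d / 2]. *)
  exists ((`|Phi u v| + 1) / (d / 2) ^+ k).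
  near=> z.
  have h1 : `|Phi z.1 z.2| <= `|Phi u v| + 1.
    have : `|Phi u v - Phi z.1 z.2| < 1.
      by near: z; move/cvgrPdist_lt: (cPhi u v Ku Kv); apply.
    move=> /ltW h; rewrite -[X in `|X|](subrK (Phi u v)) addrC.
    by apply: le_trans (ler_normD _ _) _; rewrite lerD2l distrC.
  have h2 : d / 2 <= `|z.1 - z.2|.
    have : `|d - `|z.1 - z.2| | < d / 2.
      by near: z; move/cvgrPdist_lt: cn; apply; rewrite divr_gt0.
    by move=> /ltr_normlP[_]; lra.
  apply: (le_trans h1); rewrite -mulrA ler_peMr//.
  by rewrite mulrC ler_pdivlMr ?exprn_gt0 ?divr_gt0// mul1r lerXn2r// nnegrE ?divr_ge0// ltW.
- by move=> M MP; exists M => u v Ku Kv; exact: (MP (u, v)).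
Unshelve. all: by end_near. Qed.

Lemma bounded_compact (R : realType) (n : nat) (K D : set 'rV[R]_n) F :
  compact K -> K `<=` D -> smooth_on D F -> exists M, forall u, K u -> `|F u| <= M.
Proof.
move=> cK KD sF; apply: compact_bound cK _ _ => [M M' x MM' /le_trans|x Kx]; first exact.
exists (`|F x| + 1).
have := smooth_near sF (KD _ Kx) (@ltr01 R); apply: filterS => y /ltW h.
rewrite -[X in `|X|](subrK (F x)) addrC.
by apply: le_trans (ler_normD _ _) _; rewrite lerD2l distrC.
Qed.

Lemma continuous_fst_at (R : realType) (n : nat) (D : set 'rV[R]_n) F (u v : 'rV[R]_n) :
  smooth_on D F -> D u ->
  {for (u, v), continuous (fun z : 'rV[R]_n * 'rV[R]_n => F z.1)}.
Proof.
move=> sF Du; apply: (@continuous_comp _ _ _ fst F); first exact: cvg_fst.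
exact: smooth_continuous sF Du.
Qed.

Lemma continuous_snd_at (R : realType) (n : nat) (D : set 'rV[R]_n) F (u v : 'rV[R]_n) :
  smooth_on D F -> D v ->
  {for (u, v), continuous (fun z : 'rV[R]_n * 'rV[R]_n => F z.2)}.
Proof.
move=> sF Dv; apply: (@continuous_comp _ _ _ snd F); first exact: cvg_snd.
exact: smooth_continuous sF Dv.
Qed.

Lemma lipschitz_compact (R : realType) (n : nat) (K D : set 'rV[R]_n) F :
  compact K -> K `<=` D -> open D -> smooth_on D F ->
  exists M, forall u v, K u -> K v -> `|F u - F v| <= M * `|u - v|.
Proof.
move=> cK KD oD sF.
apply: (@compact_pair_bound R n 1 K (fun u v => F u - F v)) => // [x /KD Dx|u v /KD Du /KD Dv].
  exact: (lipschitz_near oD sF Dx).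
by apply: cvgB; [exact: (continuous_fst_at sF Du)|exact: (continuous_snd_at sF Dv)].
Qed.

Lemma taylor_compact (R : realType) (n : nat) (K D : set 'rV[R]_n) F :
  compact K -> K `<=` D -> open D -> smooth_on D F ->
  exists M, forall u v, K u -> K v ->
  `|F u - F v - \sum_(f < n) partial f F v * (u - v) 0 f| <= M * `|u - v| ^+ 2.
Proof.
move=> cK KD oD sF.
apply: (@compact_pair_bound R n 2 K
  (fun u v => F u - F v - \sum_(f < n) partial f F v * (u - v) 0 f)) => //.
  by move=> x /KD Dx; exact: (taylor_near oD sF Dx).
move=> u v /KD Du /KD Dv; apply: cvgB.
  by apply: cvgB; [exact: (continuous_fst_at sF Du)|exact: (continuous_snd_at sF Dv)].
apply: cvg_big => [|f _]; first exact: add_continuous.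
apply: cvgM.
  exact: (continuous_snd_at (smooth_partial f sF) Dv).
rewrite [X in _ --> X](_ : _ = u 0 f - v 0 f); last by rewrite !mxE.
rewrite (_ : (fun z : 'rV[R]_n * 'rV[R]_n => (z.1 - z.2) 0 f) =
   (fun z => z.1 0 f - z.2 0 f)); last by apply/funext => z; rewrite !mxE.
apply: cvgB.
  by apply: (@continuous_fst_at _ _ setT (fun w => w 0 f)) => //; exact: smooth_coord.
by apply: (@continuous_snd_at _ _ setT (fun w => w 0 f)) => //; exact: smooth_coord.
Qed.

(** The derivative of a first-order Taylor remainder.  Here [A] and [B] stand for
    the gradients of [F] at the two points, [s] for the Hessian at the second one,
    [h] for the difference of the points, [p] and [q] for their derivatives.  On the
    right the first factor is again a Taylor remainder, that of the gradient, and
    the second sum is quadratic in [h] and its derivative [p - q].  The symmetry of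
    [s] matches the differentiated gradient with the remainder of the gradient. *)
Lemma taylor_gradient_algebra (R : realType) (m : nat) (A B h p q : 'I_m -> R)
    (s : 'I_m -> 'I_m -> R) : (forall f g, s f g = s g f) ->
  \sum_f A f * p f - \sum_f B f * q f -
    \sum_f ((\sum_g s g f * q g) * h f + B f * (p f - q f)) =
  \sum_f ((A f - B f - \sum_g s g f * h g) * p f + \sum_g s g f * h g * (p f - q f)).
Proof.
move=> sC; have X : \sum_f (\sum_g s g f * q g) * h f = \sum_f (\sum_g s g f * h g) * q f.
  under eq_bigr do rewrite mulr_suml.
  under [RHS]eq_bigr do rewrite mulr_suml.
  rewrite exchange_big; apply: eq_bigr => f _; apply: eq_bigr => g _ /=.
  by rewrite sC mulrAC.
rewrite big_split /= X -big_split -!sumrB; apply: eq_bigr => f _ /=.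
by rewrite -mulr_suml; move: (\sum_g _ * _) => S; ring.
Qed.

(** * Families of order eps^k *)

Section Families.
Variables (R : realType) (n : nat) (eps0 : R) (Om : set 'rV[R]_n).
Hypothesis oOm : open Om.

Let fam := R -> 'rV[R]_n -> R.

Definition dominated (k : nat) (q : fam) : Prop :=
  exists M, forall eps x, 0 < eps <= eps0 -> Om x -> `|q eps x| <= M * eps ^+ k.

Definition smooth_family (q : fam) : Prop :=
  forall eps, 0 < eps <= eps0 -> smooth_on Om (q eps).

Definition eq_family (q q' : fam) : Prop :=
  forall eps x, 0 < eps <= eps0 -> Om x -> q eps x = q' eps x.

(** The bounds in [isO], graded by the number of derivatives for the same reason
    as [smooth_upto]. *)
Fixpoint jetO (N k : nat) (q : fam) : Prop :=
  dominated k q /\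
  (if N is N'.+1 then forall i, jetO N' k (fun eps => partial i (q eps)) else True).

Lemma jetO_dominated N k q : jetO N k q -> dominated k q.
Proof. by case: N => [|N] []. Qed.

Lemma jetO_pred N k q : jetO N.+1 k q -> jetO N k q.
Proof. by elim: N q => [|N IH] q [dq pq]; split=> // i; exact: IH. Qed.

Lemma isOP k q : isO eps0 Om k q <-> smooth_family q /\ forall N, jetO N k q.
Proof.
split=> -[sq H]; split=> //.
  move=> N; elim: N q H {sq} => [|N IH] q H; split=> //; try exact: (H [::]).
  by move=> i; apply: IH => s; have := H (rcons s i); under eq_exists => M do
    under eq_forall => eps do under eq_forall => x do rewrite ipartial_rcons.
move=> s; elim/last_ind: s q H {sq} => [|s i IH] q H; first exact: jetO_dominated (H 0%N).
under eq_exists => M do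
    under eq_forall => eps do under eq_forall => x do rewrite ipartial_rcons.
by apply: (IH (fun eps => partial i (q eps))) => N; have [_] := H N.+1; exact.
Qed.

Lemma isO_smooth k q : isO eps0 Om k q -> smooth_family q.
Proof. by case. Qed.

Lemma isO_jet k q : isO eps0 Om k q -> forall N, jetO N k q.
Proof. by move=> /isOP[]. Qed.

Lemma eq_family_partial q q' i : eq_family q q' ->
  eq_family (fun eps => partial i (q eps)) (fun eps => partial i (q' eps)).
Proof.
move=> E eps x e0 Ox; apply: (partial_ext i oOm); last exact: mem_set.
by move=> y /set_mem Oy; exact: E.
Qed.

Lemma jetO_ext N k q q' : eq_family q q' -> jetO N k q -> jetO N k q'.
Proof.
elim: N q q' => [|N IH] q q' E [[M MP] pq]; (split; first by
  exists M => eps x e0 Ox; rewrite -E//; exact: MP) => //.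
by move=> i; apply: IH (pq i); exact: eq_family_partial.
Qed.

Lemma isO_ext k q q' : eq_family q q' -> isO eps0 Om k q -> isO eps0 Om k q'.
Proof.
move=> E /isOP[sq jq]; apply/isOP; split=> [eps e0|N]; last exact: jetO_ext (jq N).
by apply: smooth_ext oOm _ (sq eps e0) => x /set_mem; exact: E.
Qed.

Lemma smooth_family_partial q i : smooth_family q ->
  smooth_family (fun eps => partial i (q eps)).
Proof. by move=> sq eps e0; exact: smooth_partial (sq eps e0). Qed.

Lemma isO_partial k q i : isO eps0 Om k q -> isO eps0 Om k (fun eps => partial i (q eps)).
Proof.
move=> /isOP[sq jq]; apply/isOP; split; first exact: smooth_family_partial.
by move=> N; have [_] := jq N.+1; exact.
Qed.

Lemma jetO_add N k q q' : smooth_family q -> smooth_family q' ->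
  jetO N k q -> jetO N k q' -> jetO N k (fun eps x => q eps x + q' eps x).
Proof.
elim: N q q' => [|N IH] q q' sq sq' [[M MP] pq] [[M' MP'] pq'];
  (split; first by exists (M + M') => eps x e0 Ox; rewrite mulrDl;
     apply: le_trans (ler_normD _ _) _; apply: lerD; [exact: MP|exact: MP']) => //.
move=> i; apply: (@jetO_ext _ _ (fun eps x => partial i (q eps) x + partial i (q' eps) x)).
  move=> eps x e0 Ox; rewrite partialD//.
    exact: smooth_diff (sq eps e0) Ox.
  exact: smooth_diff (sq' eps e0) Ox.
have sp := smooth_family_partial i sq; have sp' := smooth_family_partial i sq'.
exact: (IH _ _ sp sp' (pq i) (pq' i)).
Qed.

Lemma smooth_family_mul q q' : smooth_family q -> smooth_family q' ->
  smooth_family (fun eps x => q eps x * q' eps x).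
Proof. by move=> sq sq' eps e0; exact: smooth_mul (sq _ e0) (sq' _ e0). Qed.

Lemma jetO_mul N k l q q' : smooth_family q -> smooth_family q' ->
  jetO N k q -> jetO N l q' -> jetO N (k + l) (fun eps x => q eps x * q' eps x).
Proof.
elim: N q q' => [|N IH] q q' sq sq' jq jq';
  (split; first by have [M MP] := jetO_dominated jq; have [M' MP'] := jetO_dominated jq';
    exists (M * M') => eps x e0 Ox;
    rewrite normrM exprD mulrACA ler_pM//; [exact: MP|exact: MP']) => //.
move=> i; have [[_ pq] [_ pq']] := (jq, jq').
apply: (@jetO_ext _ _ (fun eps x => partial i (q eps) x * q' eps x +
    q eps x * partial i (q' eps) x)).
  move=> eps x e0 Ox; rewrite partialM//.
    exact: smooth_diff (sq eps e0) Ox.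
  exact: smooth_diff (sq' eps e0) Ox.
have sp := smooth_family_partial i sq; have sp' := smooth_family_partial i sq'.
apply: jetO_add; [exact: smooth_family_mul|exact: smooth_family_mul|..].
- exact: (IH _ _ sp sq' (pq i) (jetO_pred jq')).
- exact: (IH _ _ sq sp' (jetO_pred jq) (pq' i)).
Qed.

Lemma isO_add k q q' : isO eps0 Om k q -> isO eps0 Om k q' ->
  isO eps0 Om k (fun eps x => q eps x + q' eps x).
Proof.
move=> /isOP[sq jq] /isOP[sq' jq']; apply/isOP; split=> [eps e0|N].
  exact: smooth_add (sq _ e0) (sq' _ e0).
exact: jetO_add.
Qed.

Lemma isO_mul k l q q' : isO eps0 Om k q -> isO eps0 Om l q' ->
  isO eps0 Om (k + l) (fun eps x => q eps x * q' eps x).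
Proof.
move=> /isOP[sq jq] /isOP[sq' jq']; apply/isOP; split=> [|N].
  exact: smooth_family_mul.
exact: jetO_mul.
Qed.

Lemma isO_const k (f : R -> R) M :
  (forall eps, 0 < eps <= eps0 -> `|f eps| <= M * eps ^+ k) ->
  isO eps0 Om k (fun eps _ => f eps).
Proof.
move=> fM; split=> [eps _|s]; first exact: smooth_cst.
under eq_exists => M' do under eq_forall => eps do
  under eq_forall => x do rewrite ipartial_cst.
case: s => [|i s]; first by exists M => eps x e0 _; exact: fM.
by exists 0 => eps x _ _; rewrite normr0 mul0r.
Qed.

Lemma isO_cst (r : R) : isO eps0 Om 0 (fun _ _ => r).
Proof. by apply: (@isO_const _ _ `|r|) => eps _; rewrite expr0 mulr1. Qed.

Lemma isO0 k : isO eps0 Om k (fun _ _ => 0).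
Proof. by apply: (@isO_const _ _ 0) => eps _; rewrite normr0 mul0r. Qed.

Lemma isO_eps k q : isO eps0 Om k q -> isO eps0 Om k.+1 (fun eps x => eps * q eps x).
Proof.
move=> qk; apply: (@isO_mul 1 k (fun eps _ => eps)) => //.
apply: (@isO_const _ _ 1) => eps /andP[e0 _].
by rewrite mul1r expr1 gtr0_norm.
Qed.

Lemma isO_opp k q : isO eps0 Om k q -> isO eps0 Om k (fun eps x => - q eps x).
Proof.
move=> qk; have := isO_mul (isO_cst (-1)) qk.
by apply: isO_ext => eps x _ _; rewrite mulN1r.
Qed.

Lemma isO_sub k q q' : isO eps0 Om k q -> isO eps0 Om k q' ->
  isO eps0 Om k (fun eps x => q eps x - q' eps x).
Proof. by move=> qk qk'; apply: isO_add => //; exact: isO_opp. Qed.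

Lemma isO_sum k (I : Type) (r : seq I) (q : I -> fam) :
  (forall j, isO eps0 Om k (q j)) ->
  isO eps0 Om k (fun eps x => \sum_(j <- r) q j eps x).
Proof.
move=> qk; elim: r => [|j r IH].
  by apply: isO_ext (isO0 k) => eps x _ _; rewrite big_nil.
by apply: isO_ext (isO_add (qk j) IH) => eps x _ _; rewrite big_cons.
Qed.

(** Since [eps] is at most [eps0], the surplus powers of [eps] are bounded. *)
Lemma isO_weaken k l q : (k <= l)%N -> isO eps0 Om l q -> isO eps0 Om k q.
Proof.
move=> kl [sq H]; split=> // s; have [M MP] := H s.
exists (`|M| * eps0 ^+ (l - k)) => eps x e0 Ox; apply: le_trans (MP _ _ e0 Ox) _.
case/andP: (e0) => e1 e2.
rewrite (_ : l = (l - k + k)%N); last by rewrite subnK.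
rewrite exprD addnK mulrA.
rewrite ler_wpM2r ?(exprn_ge0 _ (ltW e1))//.
apply: le_trans (ler_wpM2r (exprn_ge0 _ (ltW e1)) (ler_norm _)) _.
by rewrite ler_wpM2l// lerXn2r// nnegrE ltW// (lt_le_trans e1).
Qed.

Lemma jetO_sum N k (I : Type) (r : seq I) (q : I -> fam) :
  (forall j, smooth_family (q j)) -> (forall j, jetO N k (q j)) ->
  jetO N k (fun eps x => \sum_(j <- r) q j eps x).
Proof.
move=> sq jq; elim: r => [|j r IH].
  by apply: jetO_ext (isO_jet (isO0 k) N) => eps x _ _; rewrite big_nil.
apply: jetO_ext (jetO_add (sq j) _ (jq j) IH) => [eps x _ _|eps e0].
  by rewrite big_cons.
by apply: smooth_sum => // i; exact: sq.
Qed.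

Lemma smooth_family_sub q q' : smooth_family q -> smooth_family q' ->
  smooth_family (fun eps x => q eps x - q' eps x).
Proof.
by move=> sq sq' eps e0; apply: smooth_add (sq _ e0) _ => //; exact: smooth_opp (sq' _ e0).
Qed.

Lemma partial_family_sub q q' i : smooth_family q -> smooth_family q' ->
  eq_family (fun eps => partial i (fun x => q eps x - q' eps x))
    (fun eps x => partial i (q eps) x - partial i (q' eps) x).
Proof.
move=> sq sq' eps x e0 Ox; apply: deriveB; apply: diff_derivable.
  exact: smooth_diff (sq _ e0) Ox.
exact: smooth_diff (sq' _ e0) Ox.
Qed.

Section Composition.
Variables (m : nat) (K D : set 'rV[R]_m).
Hypotheses (cK : compact K) (KD : K `<=` D) (oD : open D).

Definition bounded_in (u : R -> 'rV[R]_n -> 'rV[R]_m) : Prop :=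
  (forall eps x, 0 < eps <= eps0 -> Om x -> K (u eps x)) /\
  (forall c, isO eps0 Om 0 (fun eps x => u eps x 0 c)).

Lemma smooth_family_comp u F : bounded_in u -> smooth_on D F ->
  smooth_family (fun eps x => F (u eps x)).
Proof.
move=> [uK su] sF eps e0; apply: (smooth_comp oOm _ _ sF) => [x Ox|c].
  by apply: KD; exact: uK.
exact: (isO_smooth (su c)).
Qed.

Lemma partial_family_comp u F i : bounded_in u -> smooth_on D F ->
  eq_family (fun eps => partial i (fun x => F (u eps x)))
    (fun eps x => \sum_(f < m) partial f F (u eps x) * partial i (fun y => u eps y 0 f) x).
Proof.
move=> [uK su] sF eps x e0 Ox; apply: derive_comp_row.
  by apply: differentiable_row => c; exact: smooth_diff (isO_smooth (su c) e0) Ox.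
by apply: smooth_diff sF _; apply: KD; exact: uK.
Qed.

Lemma isO_partial_coord k (u : R -> 'rV[R]_n -> 'rV[R]_m) i c :
  isO eps0 Om k (fun eps x => u eps x 0 c) ->
  isO eps0 Om k (fun eps x => partial i (fun y => u eps y 0 c) x).
Proof. exact: isO_partial. Qed.

Lemma isO_comp u F : bounded_in u -> smooth_on D F ->
  isO eps0 Om 0 (fun eps x => F (u eps x)).
Proof.
move=> bu sF; apply/isOP; split; first exact: smooth_family_comp.
move=> N; elim: N F sF => [|N IH] F sF; (split; first by
  have [M MP] := bounded_compact cK KD sF; exists M => eps x e0 Ox;
  rewrite expr0 mulr1; apply: MP; exact: bu.1) => //.
move=> i; apply: (@jetO_ext _ _ _ _ (fun eps x e0 Ox =>
  esym (partial_family_comp i bu sF e0 Ox))).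
apply: jetO_sum => f.
  apply: smooth_family_mul; first exact: smooth_family_comp (smooth_partial f sF).
  exact: isO_smooth (isO_partial_coord i (bu.2 f)).
apply: (@jetO_mul N 0 0).
- exact: smooth_family_comp (smooth_partial f sF).
- exact: isO_smooth (isO_partial_coord i (bu.2 f)).
- exact: IH (smooth_partial f sF).
- exact: isO_jet (isO_partial_coord i (bu.2 f)) N.
Qed.

Lemma dominated_dist k (u v : R -> 'rV[R]_n -> 'rV[R]_m) :
  (forall c, isO eps0 Om k (fun eps x => u eps x 0 c - v eps x 0 c)) ->
  exists2 M : R, 0 <= M & forall eps x, 0 < eps <= eps0 -> Om x ->
    `|u eps x - v eps x : 'rV[R]_m| <= M * eps ^+ k.
Proof.
move=> uv.
have /choice[M MP] : forall c, dominated k (fun eps x => u eps x 0 c - v eps x 0 c).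
  by move=> c; exact: jetO_dominated (isO_jet (uv c) 0%N).
exists (\sum_c `|M c|); first by rewrite sumr_ge0.
move=> eps x e0 Ox; have ek : 0 <= eps ^+ k by rewrite exprn_ge0// ltW//; case/andP: e0.
apply: normr_row_le => [|c]; first by rewrite mulr_ge0// sumr_ge0.
rewrite !mxE; apply: le_trans (MP c _ _ e0 Ox) _; rewrite ler_wpM2r//.
by rewrite (bigD1 c)//=; apply: le_trans (ler_norm _) _; rewrite lerDl sumr_ge0.
Qed.

(** The derivative of [F(u) - F(v)] splits into the increments of the partial
    derivatives of [F], times [du], and the partial derivatives at [v], times
    [d(u - v)].  Induction on the order handles the former; without derivatives the
    estimate is the Lipschitz inequality on [K]. *)
Lemma isO_comp_sub k u v F : bounded_in u -> bounded_in v -> smooth_on D F ->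
  (forall c, isO eps0 Om k (fun eps x => u eps x 0 c - v eps x 0 c)) ->
  isO eps0 Om k (fun eps x => F (u eps x) - F (v eps x)).
Proof.
move=> bu bv sF uv.
have sFu G : smooth_on D G -> smooth_family (fun eps x => G (u eps x)).
  exact: smooth_family_comp.
have sFv G : smooth_on D G -> smooth_family (fun eps x => G (v eps x)).
  exact: smooth_family_comp.
apply/isOP; split; first by apply: smooth_family_sub; [exact: sFu|exact: sFv].
move=> N; elim: N F sF => [|N IH] F sF; (split; first by
  have [M MP] := lipschitz_compact cK KD oD sF;
  have [M' M'0 M'P] := dominated_dist uv; exists (`|M| * M') => eps x e0 Ox;
  apply: le_trans (MP _ _ (bu.1 _ _ e0 Ox) (bv.1 _ _ e0 Ox)) _;
  apply: le_trans (ler_wpM2r (normr_ge0 _) (ler_norm _)) _;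
  rewrite -mulrA ler_wpM2l// M'P) => //.
move=> i; apply: (@jetO_ext _ _ (fun eps x => \sum_(f < m)
   ((partial f F (u eps x) - partial f F (v eps x)) * partial i (fun y => u eps y 0 f) x +
     partial f F (v eps x) * partial i (fun y => u eps y 0 f - v eps y 0 f) x))).
  move=> eps x e0 Ox; rewrite (partial_family_sub i (sFu _ sF) (sFv _ sF))//=.
  rewrite (partial_family_comp i bu sF)// (partial_family_comp i bv sF)// -sumrB; apply: eq_bigr => f _.
  rewrite (partial_family_sub i (isO_smooth (bu.2 f)) (isO_smooth (bv.2 f)))//.
  by rewrite mulrBl mulrBr addrA subrK.
have s1 f := smooth_family_sub (sFu _ (smooth_partial f sF)) (sFv _ (smooth_partial f sF)).
have s2 f := isO_smooth (isO_partial_coord i (bu.2 f)).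
have j3 f := isO_mul (isO_comp bv (smooth_partial f sF)) (isO_partial i (uv f)).
apply: jetO_sum => f.
  by move=> eps e0; apply: smooth_add; [|exact: (smooth_family_mul (s1 f) (s2 f))|
    exact: (isO_smooth (j3 f))].
apply: jetO_add; [exact: smooth_family_mul|exact: (isO_smooth (j3 f))| |exact: (isO_jet (j3 f) N)].
rewrite -[k]addn0; apply: jetO_mul => //; first exact: (IH _ (smooth_partial f sF)).
exact: isO_jet (isO_partial_coord i (bu.2 f)) N.
Qed.

(** Same induction as for [isO_comp_sub], with [taylor_gradient_algebra] for the
    inductive step and [taylor_compact] for the estimate without derivatives. *)
Lemma isO_comp_taylor k u v F : bounded_in u -> bounded_in v -> smooth_on D F ->
  (forall c, isO eps0 Om k (fun eps x => u eps x 0 c - v eps x 0 c)) ->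
  isO eps0 Om (k + k) (fun eps x => F (u eps x) - F (v eps x) -
     \sum_(f < m) partial f F (v eps x) * (u eps x 0 f - v eps x 0 f)).
Proof.
move=> bu bv sF uv.
have sFs G : smooth_on D G -> isO eps0 Om 0 (fun eps x => G (u eps x) - G (v eps x) -
     \sum_(f < m) partial f G (v eps x) * (u eps x 0 f - v eps x 0 f)).
  move=> sG; apply: isO_sub; first by apply: isO_sub; exact: isO_comp.
  apply: isO_sum => f; apply: (@isO_mul 0 0); first exact: isO_comp (smooth_partial f sG).
  exact: isO_weaken (uv f).
apply/isOP; split; first exact: isO_smooth (sFs F sF).
move=> N; elim: N F sF => [|N IH] F sF; (split; first by
  have [M MP] := taylor_compact cK KD oD sF;
  have [M' M'0 M'P] := dominated_dist uv; exists (`|M| * M' ^+ 2) => eps x e0 Ox;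
  have := MP _ _ (bu.1 _ _ e0 Ox) (bv.1 _ _ e0 Ox);
  under eq_bigr do rewrite !mxE;
  move/le_trans; apply;
  apply: le_trans (ler_wpM2r (exprn_ge0 _ (normr_ge0 _)) (ler_norm _)) _;
  rewrite -mulrA ler_wpM2l// addnn -muln2 exprM -exprMn lerXn2r// ?nnegrE ?M'P//;
  apply: le_trans (M'P _ _ e0 Ox)) => //.
move=> i; apply: (@jetO_ext _ _ (fun eps x => \sum_(f < m)
   ((partial f F (u eps x) - partial f F (v eps x) -
       \sum_(g < m) partial g (partial f F) (v eps x) * (u eps x 0 g - v eps x 0 g)) *
       partial i (fun y => u eps y 0 f) x +
     \sum_(g < m) (partial g (partial f F) (v eps x) * (u eps x 0 g - v eps x 0 g) *
       partial i (fun y => u eps y 0 f - v eps y 0 f) x)))).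
  move=> eps x e0 Ox.
  have sFu := isO_comp bu sF; have sFv := isO_comp bv sF.
  have sT f := isO_mul (isO_comp bv (smooth_partial f sF)) (uv f).
  rewrite (@partial_family_sub (fun eps x => F (u eps x) - F (v eps x)) (fun eps x =>
     \sum_(f < m) partial f F (v eps x) * (u eps x 0 f - v eps x 0 f)))//; first last.
  - exact: isO_smooth (isO_sum _ sT).
  - exact: isO_smooth (isO_sub sFu sFv).
  rewrite (partial_family_sub i (isO_smooth sFu) (isO_smooth sFv))//=.
  rewrite (partial_family_comp i bu sF)// (partial_family_comp i bv sF)//.
  rewrite partial_sum => [|f]; last exact: smooth_diff (isO_smooth (sT f) e0) Ox.
  under [X in _ - X]eq_bigr => f _.
    rewrite partialM; first last.
    - exact: smooth_diff (isO_smooth (uv f) e0) Ox.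
    - exact: smooth_diff (isO_smooth (isO_comp bv (smooth_partial f sF)) e0) Ox.
    rewrite (partial_family_comp i bv (smooth_partial f sF))//.
    rewrite (partial_family_sub i (isO_smooth (bu.2 f)) (isO_smooth (bv.2 f)))//.
    over.
  rewrite taylor_gradient_algebra; last first.
    by move=> f g; apply: (partialC f g oD sF); apply: KD; exact: bv.1.
  apply: eq_bigr => f _; congr (_ + _); apply: eq_bigr => g _.
  by rewrite (partial_family_sub i (isO_smooth (bu.2 f)) (isO_smooth (bv.2 f))).
have s2 f := isO_smooth (isO_partial_coord i (bu.2 f)).
have j3 f : isO eps0 Om (k + k) (fun eps x =>
    \sum_(g < m) (partial g (partial f F) (v eps x) * (u eps x 0 g - v eps x 0 g) *
       partial i (fun y => u eps y 0 f - v eps y 0 f) x)).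
  apply: isO_sum => g; apply: isO_mul (isO_partial i (uv f)).
  exact: (isO_mul (isO_comp bv (smooth_partial g (smooth_partial f sF))) (uv g)).
have s1 f := isO_smooth (sFs _ (smooth_partial f sF)).
apply: jetO_sum => f.
  by move=> eps e0; apply: smooth_add; [|exact: (smooth_family_mul (s1 f) (s2 f))|
    exact: (isO_smooth (j3 f))].
apply: jetO_add; [exact: smooth_family_mul|exact: (isO_smooth (j3 f))| |exact: (isO_jet (j3 f) N)].
rewrite -[(k + k)%N]addn0; apply: jetO_mul => //; first exact: (IH _ (smooth_partial f sF)).
exact: isO_jet (isO_partial_coord i (bu.2 f)) N.
Qed.

End Composition.
End Families.

(** * Smoothness of the fluid coefficients *)

Lemma sqrt_comp_diff (R : realType) (n : nat) (f : 'rV[R]_n -> R) x i :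
  0 < f x -> differentiable f x ->
  differentiable (fun y => Num.sqrt (f y)) x /\
  partial i (fun y => Num.sqrt (f y)) x = partial i f x * (2 * Num.sqrt (f x))^-1.
Proof.
move=> f0 df; have ds := is_derive1_sqrt f0.
have dS : differentiable (@Num.sqrt R) (f x).
  by apply/derivable1_diffP; exact: ex_derive.
have dc : differentiable (Num.sqrt \o f) x by exact: differentiable_comp.
split=> //; rewrite /partial [LHS](deriveE _ dc) diff_comp//= diff1E; last first.
  exact: dS.
by rewrite derive1E derive_val -deriveE.
Qed.

(** If [r] is the inverse square root of [f], its derivative is
    [- 1/2 (partial f) r^3], which is as smooth as [r]. *)
Lemma smooth_invsqrt (R : realType) (n : nat) (A : set 'rV[R]_n) f : open A ->
  (forall x, A x -> 0 < f x) -> smooth_on A f ->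
  smooth_on A (fun y => (Num.sqrt (f y))^-1).
Proof.
move=> oA f0 sf.
have s0 x : A x -> Num.sqrt (f x) != 0 by move=> Ax; rewrite gt_eqF// sqrtr_gt0 f0.
have ds x i (Ax : A x) := sqrt_comp_diff i (f0 x Ax) (smooth_diff sf Ax).
have df : forall x, A x -> differentiable (fun y => (Num.sqrt (f y))^-1) x.
  move=> x Ax; apply: (@differentiableV _ _ (fun y => Num.sqrt (f y))) (s0 x Ax).
  have dS : differentiable (@Num.sqrt R) (f x).
    by have dsx := is_derive1_sqrt (f0 x Ax); apply/derivable1_diffP; exact: ex_derive.
  by apply: (differentiable_comp _ dS); exact: smooth_diff sf Ax.
apply/smooth_onP; elim => [|N IH]; split=> // i.
have C1 : smooth_upto N A (fun y => - 2^-1 * partial i f y).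
  move: N {IH}; apply/smooth_onP; apply: smooth_mul => //; first exact: smooth_cst.
  exact: smooth_partial.
apply: (smooth_upto_ext oA _ (smooth_upto_mul oA C1 (smooth_upto_mul oA IH (smooth_upto_mul oA IH IH)))) => x /set_mem Ax.
have [dS pS] := ds x i Ax.
rewrite {2}/partial deriveV ?s0//; last exact: diff_derivable.
rewrite -/(partial i (fun y => Num.sqrt (f y)) x) pS.
have := s0 x Ax; move: (Num.sqrt _) (partial i f x) => s q s1.
by rewrite /GRing.scale /=; field.
Qed.

Lemma open_smooth_gt0 (R : realType) (n : nat) (A : set 'rV[R]_n) f : open A ->
  smooth_on A f -> open [set x | A x /\ 0 < f x].
Proof.
move=> oA sf; rewrite openE => x [Ax fx].
have := open_nbhs_nbhs (conj oA Ax); have := smooth_near sf Ax fx.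
apply: filterS2 => y /ltr_normlP[_ h] Ay; split=> //.
by move: h; rewrite ltrBlDr ltrDl.
Qed.

Section Fluid.
Variable R : realType.

Definition metric_sign (n : nat) (i : 'I_n) : R := if i == 0%N :> nat then -1 else 1.

Lemma metric_sign_sqr n (i : 'I_n) : metric_sign i * metric_sign i = 1.
Proof. by rewrite /metric_sign; case: ifP; rewrite ?mulrNN mulr1. Qed.

Lemma sharpE n (v : 'rV[R]_n) i : sharp v 0 i = v 0 i * metric_sign i.
Proof. by rewrite /sharp /eta mul_mx_diag !mxE. Qed.

Lemma etaE n (i j : 'I_n) : eta R n i j = if i == j then metric_sign i else 0.
Proof. by rewrite /eta !mxE mulrb; case: eqVneq. Qed.

Lemma smooth_greek A al : smooth_on A (fun psi : 'rV[R]_5 => greek psi 0 al).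
Proof.
by under eq_fun do rewrite mxE; exact: smooth_coord.
Qed.

Lemma smooth_sharp_greek (A : set 'rV[R]_5) al : open A ->
  smooth_on A (fun psi => sharp (greek psi) 0 al).
Proof.
move=> oA; under eq_fun do rewrite sharpE; apply: smooth_mul => //.
  exact: smooth_greek.
exact: smooth_cst.
Qed.

Lemma smooth_msq (A : set 'rV[R]_5) : open A -> smooth_on A (@msq R).
Proof.
move=> oA; apply: smooth_sum => // al; apply: smooth_mul => //.
  exact: smooth_sharp_greek.
exact: smooth_greek.
Qed.

Definition timelike : set 'rV[R]_5 := [set psi | msq psi < 0].

Lemma open_timelike : open timelike.
Proof.
have := open_smooth_gt0 openT (smooth_opp openT (smooth_msq openT)).
by congr (open _); apply/seteqP; split=> psi /=; rewrite /timelike /= oppr_gt0;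
  [case|split].
Qed.

Lemma smooth_theta : smooth_on timelike (@theta R).
Proof.
apply: smooth_invsqrt => [|psi|]; first exact: open_timelike.
  by rewrite /timelike /= oppr_gt0.
by apply: smooth_opp; [exact: open_timelike|apply: smooth_msq; exact: open_timelike].
Qed.

Lemma theta_gt0 psi : timelike psi -> 0 < @theta R psi.
Proof. by move=> h; rewrite invr_gt0 sqrtr_gt0 oppr_gt0. Qed.

Lemma smooth_thermo i : smooth_on timelike (fun psi => @thermo R psi 0 i).
Proof.
under eq_fun do rewrite mxE; case: (i == 0); first exact: smooth_theta.
exact: smooth_coord.
Qed.

Variables (E : set 'rV[R]_2) (p : 'rV[R]_2 -> R).
Hypothesis hp : is_eos E p.

Lemma states_timelike : states E `<=` timelike.
Proof. by move=> psi []. Qed.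

Lemma open_states : open (states E).
Proof.
rewrite openE => psi [tpsi fpsi Epsi].
have [oE _ _ _ _] := hp.
have n1 : \forall y \near psi, timelike y.
  by apply: open_nbhs_nbhs; split=> //; exact: open_timelike.
have n2 := smooth_near (smooth_sharp_greek 0 openT) (I : setT psi) fpsi.
have n3 : \forall y \near psi, E (thermo y).
  have dth : differentiable (@thermo R) psi.
    by apply: differentiable_row => i; exact: smooth_diff (smooth_thermo i) tpsi.
  apply: (differentiable_continuous dth).
  by apply: open_nbhs_nbhs.
apply: filterS3 n1 n2 n3 => y ty /ltr_normlP[_ h] Ey; split=> //.
by move: h; rewrite ltrBlDr ltrDl.
Qed.

Local Notation D := (states E).
Let oD := open_states.

Lemma smooth_thermo_fun q : smooth_on E q -> smooth_on D (fun psi => q (thermo psi)).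
Proof.
move=> sq; apply: (smooth_comp oD _ _ sq) => [psi []//|i].
exact: smooth_subset states_timelike (smooth_thermo i).
Qed.

Lemma smooth_theta_states : smooth_on D (@theta R).
Proof. exact: smooth_subset states_timelike smooth_theta. Qed.

Lemma theta_neq0 psi : D psi -> theta psi != 0.
Proof. by move=> /states_timelike/theta_gt0/gt_eqF ->. Qed.

Lemma smooth_Ulow al : smooth_on D (fun psi => Ulow psi 0 al).
Proof.
under eq_fun do rewrite mxE; apply: smooth_mul => //; first exact: smooth_theta_states.
exact: smooth_greek.
Qed.

Lemma smooth_Uup al : smooth_on D (fun psi => Uup psi 0 al).
Proof.
under eq_fun do rewrite sharpE; apply: smooth_mul => //; first exact: smooth_Ulow.
exact: smooth_cst.
Qed.

Lemma smooth_Pimix al be : smooth_on D (fun psi => @Pimix R psi al be).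
Proof.
under eq_fun do rewrite /Pimix /eta mul_mx_diag mxE.
apply: smooth_mul => //; last exact: smooth_cst.
under eq_fun do rewrite mxE; apply: smooth_add => //; first exact: smooth_cst.
by apply: smooth_mul => //; exact: smooth_Uup.
Qed.

Lemma smooth_T a be : smooth_on D (T p a be).
Proof.
have [_ _ sp _ _] := hp.
have sP : smooth_on D (pressure p) by exact: smooth_thermo_fun.
rewrite /T; case: unliftP => [al|] _.
  apply: smooth_add => //; last by apply: smooth_mul => //; exact: smooth_cst.
  apply: smooth_mul => //; last exact: smooth_Uup.
  apply: smooth_mul => //; last exact: smooth_Uup.
  apply: smooth_add => //; apply: smooth_add => //; last exact: smooth_opp.
  apply: smooth_mul => //; first exact: smooth_theta_states.
  by apply: smooth_thermo_fun; exact: smooth_partial.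
apply: smooth_mul => //; last exact: smooth_Uup.
apply: smooth_mul => //; first by apply: smooth_thermo_fun; exact: smooth_partial.
by apply: smooth_inv => //; [exact: theta_neq0|exact: smooth_theta_states].
Qed.

Variables (lambda mu nu : 'rV[R]_5 -> R).
Hypotheses (hl : smooth_on D lambda) (hm : smooth_on D mu) (hn : smooth_on D nu).

Lemma smooth_C a b : smooth_on D (fun psi => C lambda mu nu psi a b).
Proof.
have sit : smooth_on D (fun psi => (theta psi)^-1).
  by apply: smooth_inv => //; [exact: theta_neq0|exact: smooth_theta_states].
under eq_fun do rewrite mxE.
case: unliftP => [al|] _; case: unliftP => [be|] _ //; try exact: smooth_cst.
apply: smooth_add => //; apply: smooth_mul => //; last exact: smooth_Pimix.
- apply: smooth_mul => //; last exact: smooth_Uup.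
  apply: smooth_mul => //; under eq_fun do rewrite expr2 invfM.
  exact: smooth_mul.
- exact: smooth_Ulow.
- exact: smooth_mul.
Qed.

Lemma smooth_Sup a be c : smooth_on D (Sup p lambda mu nu a be c).
Proof.
apply: smooth_sum => // b; apply: smooth_mul => //; first exact: smooth_C.
by apply: smooth_partial; exact: smooth_T.
Qed.

Lemma SlowE f de c psi :
  Slow p lambda mu nu f de c psi = metric_sign f * Sup p lambda mu nu f de c psi.
Proof.
rewrite /Slow (bigD1 f)//= big1 => [|a af]; first by rewrite etaE eqxx addr0.
by rewrite etaE eq_sym (negbTE af) mul0r.
Qed.

End Fluid.

(** * The gradient shift *)

Section Shift.
Variables (R : realType) (p : 'rV[R]_2 -> R) (eps0 : R) (Om : set 'rV[R]_4).
Variables (D K : set 'rV[R]_5).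
Hypotheses (oOm : open Om) (cK : compact K) (KD : K `<=` D) (oD : open D).
Hypothesis sT : forall a be, smooth_on D (T p a be).

Local Notation bounded := (bounded_in eps0 Om K).
Local Notation isOm := (isO eps0 Om).
Local Notation coefs := ('I_5 -> 'I_4 -> 'I_5 -> 'I_4 -> 'rV[R]_5 -> R).

Lemma isO_gradient_form (A : coefs) a be (u : R -> 'rV[R]_4 -> 'rV[R]_5) :
  (forall c de, smooth_on D (A a be c de)) -> bounded u ->
  isOm 0 (fun eps x => \sum_(c < 5) \sum_(de < 4)
        A a be c de (u eps x) * partial de (fun y => u eps y 0 c) x).
Proof.
move=> sA bu; apply: (isO_sum oOm) => c; apply: (isO_sum oOm) => de.
apply: (isO_mul oOm (k := 0) (l := 0)); first exact: (isO_comp oOm cK KD).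
exact: isO_partial_coord (bu.2 c).
Qed.

(** The divergence of the ideal tensor, the part of both systems of order zero in
    [eps]. *)
Definition ideal_div (u : R -> 'rV[R]_4 -> 'rV[R]_5) a eps x :=
  \sum_(be < 4) partial be (fun y => T p a be (u eps y)) x.

(** The system says that the ideal divergence is [- eps] times the divergence of
    the gradient form. *)
Lemma isO_ideal_div (A : coefs) (u : R -> 'rV[R]_4 -> 'rV[R]_5) a :
  (forall a be c de, smooth_on D (A a be c de)) -> bounded u ->
  (forall eps, 0 < eps <= eps0 -> solves p A eps Om (u eps)) ->
  isOm 1 (ideal_div u a).
Proof.
move=> sA bu sol.
pose G be eps x := \sum_(c < 5) \sum_(de < 4)
        A a be c de (u eps x) * partial de (fun y => u eps y 0 c) x.
have oG be : isOm 0 (G be) by exact: isO_gradient_form.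
have oT be : isOm 0 (fun eps x => T p a be (u eps x)).
  exact: (isO_comp oOm cK KD).
have oP : isOm 1 (fun eps x => - (eps * \sum_(be < 4) partial be (G be eps) x)).
  apply: (isO_opp oOm); apply: (isO_eps oOm); apply: (isO_sum oOm) => be.
  exact: isO_partial (oG be).
apply: (isO_ext oOm) oP => eps x e0 Ox; apply/esym/eqP.
rewrite -addr_eq0 mulr_sumr -big_split -[X in _ == X](sol eps e0 a x Ox) /=.
apply/eqP; apply: eq_bigr => be _; rewrite /flux.
rewrite (partialD (f := fun y => T p a be (u eps y)) (g := fun y => eps * G be eps y)).
- congr (_ + _); rewrite (partialM (f := fun=> eps)) ?partial_cst ?mul0r ?add0r//.
  exact: smooth_diff (isO_smooth (oG be) e0) Ox.
- exact: smooth_diff (isO_smooth (oT be) e0) Ox.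
- apply: differentiableM => //.
  exact: smooth_diff (isO_smooth (oG be) e0) Ox.
Qed.

Lemma isO_ideal_div_sub k (u v : R -> 'rV[R]_4 -> 'rV[R]_5) a :
  bounded u -> bounded v ->
  (forall c, isOm k (fun eps x => u eps x 0 c - v eps x 0 c)) ->
  isOm k (fun eps x => ideal_div u a eps x - ideal_div v a eps x).
Proof.
move=> bu bv uv.
have oT (w : R -> 'rV[R]_4 -> 'rV[R]_5) be : bounded w ->
    isOm 0 (fun eps x => T p a be (w eps x)).
  by move=> bw; exact: (isO_comp oOm cK KD).
have oP : isOm k (fun eps x => \sum_(be < 4)
    partial be (fun y => T p a be (u eps y) - T p a be (v eps y)) x).
  apply: (isO_sum oOm) => be.
  apply: (isO_partial (q := fun eps y => T p a be (u eps y) - T p a be (v eps y))).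
  exact: (isO_comp_sub oOm cK KD).
apply: (isO_ext oOm) oP => eps x e0 Ox; rewrite -sumrB; apply: eq_bigr => be _.
exact: (partial_family_sub be (isO_smooth (oT u be bu)) (isO_smooth (oT v be bv))).
Qed.

Variables (lambda mu nu : 'rV[R]_5 -> R).
Hypothesis sC : forall a b, smooth_on D (fun psi => C lambda mu nu psi a b).

(** The reason for the choice of [S]: contracting the derivative of [T] in the
    state with the gradient of the state gives the derivative of [T] in space-time. *)
Lemma Delta_ideal_div (u : R -> 'rV[R]_4 -> 'rV[R]_5) a : bounded u ->
  eq_family eps0 Om (fun eps x => Delta p lambda mu nu (u eps) a x)
   (fun eps x => \sum_(b < 5) C lambda mu nu (u eps x) a b * ideal_div u b eps x).
Proof.
move=> bu eps x e0 Ox; rewrite /Delta /ideal_div.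
under eq_bigr do under eq_bigr do rewrite /Sup mulr_suml.
under eq_bigr do rewrite exchange_big.
rewrite exchange_big; apply: eq_bigr => b _; rewrite mulr_sumr; apply: eq_bigr => be _.
rewrite (partial_family_comp KD be bu (sT b be))// mulr_sumr; apply: eq_bigr => c _.
by rewrite mulrA.
Qed.

Lemma isO_Delta k (u : R -> 'rV[R]_4 -> 'rV[R]_5) a : bounded u ->
  (forall b, isOm k (ideal_div u b)) ->
  isOm k (fun eps x => Delta p lambda mu nu (u eps) a x).
Proof.
move=> bu du; have oP : isOm k (fun eps x =>
    \sum_(b < 5) C lambda mu nu (u eps x) a b * ideal_div u b eps x).
  apply: (isO_sum oOm) => b; apply: (isO_mul oOm (k := 0)) => //.
  exact: (isO_comp oOm cK KD bu (sC a b)).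
by apply: (isO_ext oOm) oP => eps x e0 Ox; rewrite -Delta_ideal_div.
Qed.

End Shift.

Theorem theorem1 (R : realType)
  (E : set 'rV[R]_2) (p : 'rV[R]_2 -> R) (hp : is_eos E p)
  (B : 'I_5 -> 'I_4 -> 'I_5 -> 'I_4 -> 'rV[R]_5 -> R)
  (hB : forall a be c de, smooth_on (states E) (B a be c de))
  (lambda mu nu : 'rV[R]_5 -> R)
  (hlambda : smooth_on (states E) lambda)
  (hmu : smooth_on (states E) mu)
  (hnu : smooth_on (states E) nu)
  (Om : set 'rV[R]_4) (hOm : open Om)
  (eps0 : R) (heps0 : 0 < eps0)
  (psit psi : R -> 'rV[R]_4 -> 'rV[R]_5)
  (hpsit : bounded_smooth_family (states E) eps0 Om psit)
  (hshift : forall eps x (a : 'I_5), 0 < eps <= eps0 -> Om x ->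
     sharp (psi eps x) 0 a =
       sharp (psit eps x) 0 a + eps * Delta p lambda mu nu (psit eps) a x)
  (hpsi : values_in_compact (states E) eps0 Om psi)
  (hsol :
     (forall eps, 0 < eps <= eps0 ->
        solves p (Btilde p lambda mu nu B) eps Om (psit eps)) \/
     (forall eps, 0 < eps <= eps0 -> solves p B eps Om (psi eps))) :
  forall (a : 'I_5) (be : 'I_4),
    isO eps0 Om 3 (fun eps x =>
      flux p B eps (psi eps) a be x -
      flux p (Btilde p lambda mu nu B) eps (psit eps) a be x).
Proof.
have oD := open_states hp; have sT := smooth_T hp.
have sC := smooth_C hp hlambda hmu hnu.
have sS := smooth_Sup hp hlambda hmu hnu.
have [[K1 [cK1 K1D psitK]] spsit bpsit] := hpsit.
have [K2 [cK2 K2D psiK]] := hpsi.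
pose K := K1 `|` K2.
have cK : compact K by exact: compactU.
have KD : K `<=` states E by rewrite subUset.
have bw : bounded_in eps0 Om K psit.
  split=> [eps x e0 Ox|c]; first by left; exact: psitK.
  split=> [eps e0|s]; first exact: spsit.
  by have [M MP] := bpsit c s; exists M => eps x e0 Ox; rewrite expr0 mulr1; exact: MP.
pose De a eps x := Delta p lambda mu nu (psit eps) a x.
have shift eps x c : 0 < eps <= eps0 -> Om x ->
    psi eps x 0 c = psit eps x 0 c + eps * (metric_sign R c * De c eps x).
  move=> e0 Ox; have /(congr1 ( *%R (metric_sign R c))) := hshift eps x c e0 Ox.
  rewrite !sharpE mulrDr ![metric_sign R c * (_ 0 c * _)]mulrCA metric_sign_sqr !mulr1 => ->.
  by rewrite mulrCA.
have divw0 b : isO eps0 Om 0 (ideal_div p psit b).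
  apply: (isO_sum hOm) => be'.
  exact: isO_partial (isO_comp hOm cK KD bw (sT b be')).
have sDe k : (forall c, isO eps0 Om k (De c)) ->
    forall c, isO eps0 Om k.+1 (fun eps x => psi eps x 0 c - psit eps x 0 c).
  move=> oDe c; have := isO_eps hOm (isO_mul hOm (isO_cst eps0 Om (metric_sign R c)) (oDe c)).
  by apply: (isO_ext hOm) => eps x e0 Ox; rewrite shift// addrC addKr.
(* Without the equations, [Delta] is only bounded; this already makes [psi] a
   bounded family. *)
have h1 := sDe 0%N (fun c => isO_Delta hOm cK KD sT sC c bw divw0).
have bu : bounded_in eps0 Om K psi.
  split=> [eps x e0 Ox|c]; first by right; exact: psiK.
  have := isO_add hOm (isO_weaken (leq0n 1) (h1 c)) (bw.2 c).
  by apply: (isO_ext hOm) => eps x e0 Ox; rewrite subrK.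
have sBt a be c de : smooth_on (states E) (Btilde p lambda mu nu B a be c de).
  apply: smooth_add => //; apply: smooth_sum => // f; apply: smooth_mul => //.
    exact: smooth_partial.
  rewrite (_ : Slow _ _ _ _ _ _ _ = fun psi => metric_sign R f * Sup p lambda mu nu f de c psi).
    by apply: smooth_mul => //; exact: smooth_cst.
  by apply/funext => psi'; exact: SlowE.
have divw b : isO eps0 Om 1 (ideal_div p psit b).
  case: hsol => sol; first exact: (isO_ideal_div hOm cK KD sT b sBt bw sol).
  have := isO_sub hOm (isO_ideal_div hOm cK KD sT b hB bu sol)
    (isO_ideal_div_sub hOm cK KD oD sT b bu bw h1).
  by apply: (isO_ext hOm) => eps x e0 Ox; rewrite opprB addrC subrK.
(* The equations gain the second power of [eps]. *)
have h2 := sDe 1%N (fun c => isO_Delta hOm cK KD sT sC c bw divw).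
move=> a be.
have oTaylor := isO_comp_taylor hOm cK KD oD bu bw (sT a be) h2.
have oB : isO eps0 Om 2 (fun eps x => \sum_(c < 5) \sum_(de < 4)
    ((B a be c de (psi eps x) - B a be c de (psit eps x)) *
       partial de (fun y => psi eps y 0 c) x +
     B a be c de (psit eps x) *
       partial de (fun y => psi eps y 0 c - psit eps y 0 c) x)).
  apply: (isO_sum hOm) => c; apply: (isO_sum hOm) => de; apply: (isO_add hOm).
    apply: (isO_mul hOm (k := 2) (l := 0)).
      exact: (isO_comp_sub hOm cK KD oD bu bw (hB a be c de) h2).
    exact: isO_partial_coord (bu.2 c).
  apply: (isO_mul hOm (k := 0) (l := 2)); first exact: (isO_comp hOm cK KD bw).
  by have := isO_partial de (h2 c).
have := isO_add hOm (isO_weaken (isT : (3 <= 2 + 2)%N) oTaylor) (isO_eps hOm oB).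
apply: (isO_ext hOm) => eps x e0 Ox; rewrite /flux.
have -> : \sum_(c < 5) \sum_(de < 4) Btilde p lambda mu nu B a be c de (psit eps x) *
      partial de (fun y => psit eps y 0 c) x =
    \sum_(c < 5) \sum_(de < 4) B a be c de (psit eps x) *
      partial de (fun y => psit eps y 0 c) x +
    \sum_f partial f (T p a be) (psit eps x) * (metric_sign R f * De f eps x).
  rewrite /De /Delta; under [X in _ + X]eq_bigr do rewrite mulr_sumr mulr_sumr.
  rewrite [X in _ + X]exchange_big /=.
  under [X in _ + X]eq_bigr do under eq_bigr do rewrite mulr_sumr mulr_sumr.
  under [X in _ + X]eq_bigr do rewrite exchange_big.
  rewrite [X in _ + X]exchange_big -big_split; apply: eq_bigr => c _ /=.
  rewrite -big_split; apply: eq_bigr => de _ /=.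
  rewrite /Btilde mulrDl mulr_suml; congr (_ + _); apply: eq_bigr => f _.
  by rewrite SlowE -!mulrA.
have -> : \sum_f partial f (T p a be) (psit eps x) * (psi eps x 0 f - psit eps x 0 f) =
   eps * \sum_f partial f (T p a be) (psit eps x) * (metric_sign R f * De f eps x).
  rewrite mulr_sumr; apply: eq_bigr => f _; rewrite shift// addrC addKr.
  by rewrite mulrCA.
have -> : \sum_(c < 5) \sum_(de < 4)
    ((B a be c de (psi eps x) - B a be c de (psit eps x)) *
       partial de (fun y => psi eps y 0 c) x +
     B a be c de (psit eps x) *
       partial de (fun y => psi eps y 0 c - psit eps y 0 c) x) =
   \sum_(c < 5) \sum_(de < 4) B a be c de (psi eps x) *
      partial de (fun y => psi eps y 0 c) x -
   \sum_(c < 5) \sum_(de < 4) B a be c de (psit eps x) *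
      partial de (fun y => psit eps y 0 c) x.
  rewrite -sumrB; apply: eq_bigr => c _; rewrite -sumrB; apply: eq_bigr => de _.
  rewrite (partial_family_sub de (isO_smooth (bu.2 c)) (isO_smooth (bw.2 c)))//.
  by rewrite mulrBl mulrBr addrA subrK.
move: (\sum_(c < 5) \sum_(de < 4) B a be c de (psi eps x) * _).
move: (\sum_(c < 5) \sum_(de < 4) B a be c de (psit eps x) * _).
move: (\sum_f _) (T p a be (psi eps x)) (T p a be (psit eps x)) => S t1 t2 g1 g2.
clear; ring.
Qed.
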